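(* Let $X, Y \subseteq \omega$. There exists an embedding $\mathcal{B}^X \hookrightarrow \mathcal{G}^Y$ if and only if $X \oplus \overline{X} \le_e Y$.
   Context: A pca is a set with a partial binary application operation containing distinct $\mathrm{s},\mathrm{k}$ with $\mathrm{k}ab\downarrow=a$, $\mathrm{s}ab\downarrow$, $\mathrm{s}abc\simeq(ac)(bc)$. An embedding of pcas is an injective map $f$ with: if $ab$ is defined then $f(a)f(b)$ is defined and equals $f(ab)$. $\mathcal{B}^X$: elements are the partial $X$-computable functions $\omega\rightharpoonup\omega$; application $\varphi\cdot\psi$ is the partial function $n\mapsto\Phi^{\varphi\oplus\psi}_{\varphi(0)}(n)$, where $\Phi_e$ is the $e$-th Turing functional, $(\varphi\oplus\psi)(2n)\simeq\varphi(n)$, $(\varphi\oplus\psi)(2n+1)\simeq\psi(n)$, and querying the oracle at an undefined point diverges. Scott's graph model: on $\mathcal{P}(\omega)$, $A\cdot B=\{n:\exists u\,(\langle n,u\rangle\in A\wedge D_u\subseteq B)\}$, with $\langle\cdot,\cdot\rangle$ a bijective computable pairing, $\langle 0,0\rangle=0$, and $D_u$ the finite set with canonical code $u$. $\mathcal{G}^Y$ is the least class containing $Y$ and all c.e. sets and closed under this application (equivalently, all sets $\le_e Y$). $A\le_e Y$ (enumeration reducibility) means there is a c.e. relation $R$ with $x\in A \iff \exists u\,(R(x,u)\wedge D_u\subseteq Y)$. $X\oplus\overline X=\{2n:n\in X\}\cup\{2n+1:n\notin X\}$. *)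

(* Defs.v *)
From mathcomp Require Import all_boot.
Set Implicit Arguments. Unset Strict Implicit. Unset Printing Implicit Defensive.

Inductive prf : Type :=
| PZero
| PSucc
| PProj of nat
| PComp of prf & seq prf
| PPrec of prf & prf
| PMu of prf
| POrac.

(* partial functions omega -> omega as (single-valued) graphs *)
Definition pfun := nat -> nat -> Prop.

(* Big-step semantics relative to a partial oracle O : pfun.
   Querying the oracle at a point where it is undefined diverges. *)
Inductive eval (O : pfun) : prf -> seq nat -> nat -> Prop :=
| ev_zero args : eval O PZero args 0
| ev_succ args : eval O PSucc args (head 0 args).+1
| ev_proj i args : eval O (PProj i) args (nth 0 args i)
| ev_comp f gs args ys v :
    evals O gs args ys -> eval O f ys v -> eval O (PComp f gs) args v
| ev_prec0 f g rest v : eval O f rest v -> eval O (PPrec f g) (0 :: rest) v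
| ev_precS f g n rest w v :
    eval O (PPrec f g) (n :: rest) w -> eval O g [:: n, w & rest] v ->
    eval O (PPrec f g) (n.+1 :: rest) v
| ev_mu f args n :
    eval O f (n :: args) 0 ->
    (forall m, m < n -> exists k, eval O f (m :: args) k.+1) ->
    eval O (PMu f) args n
| ev_orac args v : O (head 0 args) v -> eval O POrac args v
with evals (O : pfun) : seq prf -> seq nat -> seq nat -> Prop :=
| evs_nil args : evals O [::] args [::]
| evs_cons g gs args y ys :
    eval O g args y -> evals O gs args ys -> evals O (g :: gs) args (y :: ys).

(* A fixed effective Goedel numbering of the oracle programs, obtained  *)
(* from the canonical countable structure of GenTree.tree nat.          *)
Fixpoint all_some (s : seq (option prf)) : option (seq prf) :=
  match s with
  | [::] => Some [::]
  | Some p :: s' => omap (cons p) (all_some s')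
  | None :: _ => None
  end.

Fixpoint tree_to_prf (t : GenTree.tree nat) : option prf :=
  match t with
  | GenTree.Node 0 [::] => Some PZero
  | GenTree.Node 1 [::] => Some PSucc
  | GenTree.Node 2 [:: GenTree.Leaf i] => Some (PProj i)
  | GenTree.Node 3 (tf :: tgs) =>
      match tree_to_prf tf, all_some (map tree_to_prf tgs) with
      | Some f, Some gs => Some (PComp f gs)
      | _, _ => None
      end
  | GenTree.Node 4 [:: tf; tg] =>
      match tree_to_prf tf, tree_to_prf tg with
      | Some f, Some g => Some (PPrec f g)
      | _, _ => None
      end
  | GenTree.Node 5 [:: tf] => omap PMu (tree_to_prf tf)
  | GenTree.Node 6 [::] => Some POrac
  | _ => None
  end.

(* the e-th program (a surjective, computable numbering) *)
Definition decode (e : nat) : prf :=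
  odflt PZero (obind tree_to_prf (unpickle e : option (GenTree.tree nat))).

Definition Phi (e : nat) (O : pfun) (n v : nat) : Prop := eval O (decode e) [:: n] v.

Definition chi (X : nat -> Prop) : pfun :=
  fun n v => (X n /\ v = 1) \/ (~ X n /\ v = 0).

Definition pjoin (phi psi : pfun) : pfun :=
  fun m v => if odd m then psi m./2 v else phi m./2 v.

Definition join_compl (X : nat -> Prop) : nat -> Prop :=
  fun m => if odd m then ~ X m./2 else X m./2.

Definition inB (X : nat -> Prop) (phi : pfun) : Prop :=
  exists e, forall n v, phi n v <-> Phi e (chi X) n v.

Definition appB (phi psi : pfun) : pfun :=
  fun n v => exists e, phi 0 e /\ Phi e (pjoin phi psi) n v.

(* Cantor pairing: bijective, computable, <0,0> = 0 *)
Definition cpair (n u : nat) : nat := ((n + u) * (n + u).+1) %/ 2 + u.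

(* canonical finite sets: x in D_u iff bit x of u is 1 *)
Definition D (u : nat) (x : nat) : Prop := odd (u %/ 2 ^ x).

Definition appG (A B : nat -> Prop) : nat -> Prop :=
  fun n => exists u, A (cpair n u) /\ (forall x, D u x -> B x).

(* c.e. binary relations: domains of (oracle-free) partial recursive functions *)
Definition ce_rel (R : nat -> nat -> Prop) : Prop :=
  exists e, forall x u, R x u <-> exists v, eval (chi (fun _ => False)) (decode e) [:: x; u] v.

Definition le_e (A Y : nat -> Prop) : Prop :=
  exists R, ce_rel R /\ forall x, A x <-> exists u, R x u /\ (forall y, D u y -> Y y).

Definition inG (Y : nat -> Prop) (A : nat -> Prop) : Prop := le_e A Y.

(* Embeddings B^X -> G^Y.  Both applications are total, so the          *)
(* definedness clause is automatic; equality of elements is equality    *)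
(* of graphs / sets.                                                    *)
Definition embedding_BG (X Y : nat -> Prop) (f : pfun -> (nat -> Prop)) : Prop :=
  [/\ (forall phi, inB X phi -> inG Y (f phi)),
      (forall phi psi, inB X phi -> inB X psi -> f phi = f psi -> phi = psi)
    & (forall phi psi, inB X phi -> inB X psi ->
         f (appB phi psi) = appG (f phi) (f psi))].

(* Main.v *)
Require Import Defs.
From mathcomp Require Import all_boot zify.
From Stdlib Require Import Classical FunctionalExtensionality PropExtensionality.
Set Implicit Arguments. Unset Strict Implicit. Unset Printing Implicit Defensive.

(* (=>) The constant functions serve as numerals of B^X. Their images are enumerated from Y by
   iterating the image of a successor element, and an element of B^X sends the n-th numeral to
   the numeral 1 or 0 according to whether n is in X. Since a negation element exchanges 0 and 1
   and application in the graph model is monotone, neither of the images of 0 and 1 contains the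
   other, so each of the two answers is detected by the presence of a fixed point.

   (<=) Send phi to the least set G(phi) containing 0, a token <0, <n,v>+1> for every value
   phi(n) = v, and <m,u> whenever m > 0 is in G(phi . theta), where theta is the finite function
   whose tokens lie in D_u. The tokens make G injective, and continuity of application makes it
   a homomorphism; as <0,0> = 0 belongs to every G(phi), the tokens add nothing to applications.

   All enumerability claims are reduced to one: the atoms derivable from a base set by finitely
   many computable Horn clauses are enumeration reducible to that set. Evaluation of oracle
   programs, and then G itself, are least fixed points of such clauses. *)

(** * Evaluation and computable functions *)

Section Eval.
Variable O : pfun.
Implicit Types (a ys : seq nat) (v : nat).

Lemma eval_zeroE a v : eval O PZero a v <-> v = 0.
Proof. by split=> [H | ->]; [inversion H | constructor]. Qed.

Lemma eval_succE a v : eval O PSucc a v <-> v = (head 0 a).+1.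
Proof. by split=> [H | ->]; [inversion H | constructor]. Qed.

Lemma eval_projE i a v : eval O (PProj i) a v <-> v = nth 0 a i.
Proof. by split=> [H | ->]; [inversion H | constructor]. Qed.

Lemma eval_oracE a v : eval O POrac a v <-> O (head 0 a) v.
Proof. by split=> [H | H]; [inversion H | constructor]. Qed.

Lemma eval_compE f gs a v :
  eval O (PComp f gs) a v <-> exists2 ys, evals O gs a ys & eval O f ys v.
Proof.
split=> [H | [ys H1 H2]]; last exact: ev_comp H1 H2.
by inversion H; subst; exists ys.
Qed.

Lemma eval_prec0E f g a v : eval O (PPrec f g) (0 :: a) v <-> eval O f a v.
Proof. by split=> [H | H]; [inversion H | constructor]. Qed.

Lemma eval_precSE f g n a v : eval O (PPrec f g) (n.+1 :: a) v <->
  exists2 w, eval O (PPrec f g) (n :: a) w & eval O g [:: n, w & a] v.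
Proof.
split=> [H | [w H1 H2]]; last exact: ev_precS H1 H2.
by inversion H; subst; exists w.
Qed.

Lemma evals_nilE a ys : evals O [::] a ys <-> ys = [::].
Proof. by split=> [H | ->]; [inversion H | constructor]. Qed.

Lemma evals_consE g gs a ys : evals O (g :: gs) a ys <->
  exists y ys', [/\ ys = y :: ys', eval O g a y & evals O gs a ys'].
Proof.
split=> [H | [y [ys' [-> H1 H2]]]]; last exact: evs_cons H1 H2.
by inversion H; subst; exists y, ys0.
Qed.

Lemma eval_muE f a n : eval O (PMu f) a n <->
  eval O f (n :: a) 0 /\ forall m, m < n -> exists k, eval O f (m :: a) k.+1.
Proof.
split=> [H | [H1 H2]]; last exact: ev_mu H1 H2.
by inversion H; subst.
Qed.

End Eval.

(* [n] is the arity: a program is only constrained on argument lists of that length. *)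
Definition computes n (f : seq nat -> nat) p :=
  forall O a, size a = n -> forall v, eval O p a v <-> v = f a.
Definition computable n f := exists p, computes n f p.

Lemma eq_computable n f g : f =1 g -> computable n f -> computable n g.
Proof. by move=> fg [p Hp]; exists p => O a sa v; rewrite -fg; apply: Hp. Qed.

Lemma computable_proj n i : computable n (fun a => nth 0 a i).
Proof. by exists (PProj i) => O a _ v; apply: eval_projE. Qed.

Lemma computable_compose n m f (gs : seq (seq nat -> nat)) :
  computable m f -> size gs = m -> (forall i, i < m -> computable n (nth (fun _ => 0) gs i)) ->
  computable n (fun a => f [seq g a | g <- gs]).
Proof.
move=> [p Hp] sgs Hgs.
have [qs Hqs] : exists qs, forall O a, size a = n -> forall ys,
    evals O qs a ys <-> ys = [seq g a | g <- gs].
  rewrite -{}sgs in Hgs; elim: gs Hgs => [|g gs IH] Hgs.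
    by exists [::] => O a _ ys; apply: evals_nilE.
  have [q Hq] := Hgs 0 isT.
  have [|qs Hqs] := IH; first by move=> i; apply: (Hgs i.+1).
  exists (q :: qs) => O a sa ys; rewrite evals_consE; split=> [[y [ys' [-> ]]]|->].
    by move/(Hq _ _ sa) => -> /(Hqs _ _ sa) ->.
  by exists (g a), [seq g a | g <- gs]; split=> //; [apply/(Hq _ _ sa)|apply/(Hqs _ _ sa)].
exists (PComp p qs) => O a sa v; rewrite eval_compE; split=> [[ys /(Hqs _ _ sa) ->]|->].
  by move/Hp; apply; rewrite size_map.
by exists [seq g a | g <- gs]; [apply/(Hqs _ _ sa)|apply/Hp; rewrite ?size_map].
Qed.

Lemma computable1 n f g : computable 1 f -> computable n g ->
  computable n (fun a => f [:: g a]).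
Proof. by move=> cf cg; apply: (computable_compose (gs := [:: g]) cf) => // -[]. Qed.

Lemma computable2 n f g h : computable 2 f -> computable n g -> computable n h ->
  computable n (fun a => f [:: g a; h a]).
Proof. by move=> cf cg ch; apply: (computable_compose (gs := [:: g; h]) cf) => // -[|[]]. Qed.

Lemma computable3 n f g h k : computable 3 f -> computable n g -> computable n h ->
  computable n k -> computable n (fun a => f [:: g a; h a; k a]).
Proof. by move=> cf cg ch ck; apply: (computable_compose (gs := [:: g; h; k]) cf) => // -[|[|[]]]. Qed.

Lemma computable_succ n f : computable n f -> computable n (fun a => (f a).+1).
Proof.
move=> cf; apply: (@computable1 _ (fun a => (head 0 a).+1)) => //.
by exists PSucc => O a _ v; apply: eval_succE.
Qed.

Lemma computable_const n c : computable n (fun _ => c).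
Proof.
elim: c => [|c IH]; last exact: computable_succ.
by exists PZero => O a _ v; apply: eval_zeroE.
Qed.

Fixpoint primrec (f g : seq nat -> nat) k a :=
  if k is k'.+1 then g [:: k', primrec f g k' a & a] else f a.

Lemma computable_prec n f g : computable n f -> computable n.+2 g ->
  computable n.+1 (fun a => primrec f g (head 0 a) (behead a)).
Proof.
move=> [p Hp] [q Hq]; exists (PPrec p q) => O [|k a] //= [sa] v.
elim: k v => [|k IH] v /=; first by rewrite eval_prec0E; apply: Hp.
rewrite eval_precSE; split=> [[w /IH ->] /Hq|->]; first by apply; rewrite /= sa.
by exists (primrec f g k a); [apply/IH | apply/Hq; rewrite /= ?sa].
Qed.

Definition recursive1 (f : nat -> nat) := computable 1 (fun a => f (head 0 a)).
Definition recursive2 (f : nat -> nat -> nat) :=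
  computable 2 (fun a => f (nth 0 a 0) (nth 0 a 1)).
Definition recursive3 (f : nat -> nat -> nat -> nat) :=
  computable 3 (fun a => f (nth 0 a 0) (nth 0 a 1) (nth 0 a 2)).

Lemma computable_comp n f g : recursive1 f -> computable n g -> computable n (fun a => f (g a)).
Proof. exact: computable1. Qed.

Lemma computable_comp2 n f g h : recursive2 f -> computable n g -> computable n h ->
  computable n (fun a => f (g a) (h a)).
Proof. exact: computable2. Qed.

Lemma computable_comp3 n f g h k : recursive3 f -> computable n g -> computable n h ->
  computable n k -> computable n (fun a => f (g a) (h a) (k a)).
Proof. exact: computable3. Qed.

(** [PPrec] recurses on its first argument and passes on the others as parameters, so the program
    evaluates the bound [f a] and puts it in front of a copy of [a] rebuilt by projections. *)
Lemma computable_iteri n (f g h : seq nat -> nat) :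
  computable n f -> computable n h -> computable n.+2 g ->
  computable n (fun a => iteri (f a) (fun i w => g [:: i, w & a]) (h a)).
Proof.
move=> cf ch cg; have [p Hp] := computable_prec ch cg.
have [q Hq] := cf.
exists (PComp p (q :: [seq PProj i | i <- iota 0 n])) => O a sa v.
have E : iteri (f a) (fun i w => g [:: i, w & a]) (h a) =
         primrec h g (head 0 (f a :: a)) (behead (f a :: a)).
  by rewrite /=; elim: (f a) => //= k ->.
have Ha : forall ys, evals O [seq PProj i | i <- iota 0 n] a ys <-> ys = a.
  have sub m k ys : m + k = n ->
      evals O [seq PProj i | i <- iota m k] a ys <-> ys = drop m a.
    elim: k m ys => [|k IH] m ys mk /=.
      by rewrite drop_oversize ?evals_nilE // sa -mk addn0.
    rewrite evals_consE (drop_nth 0) ?sa; last by lia.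
    split=> [[y [ys' [->]]] /eval_projE -> /IH ->|->] //; first lia.
    exists (nth 0 a m), (drop m.+1 a); split=> //; first exact/eval_projE.
    by apply/IH => //; lia.
  by move=> ys; rewrite sub ?drop0.
rewrite E eval_compE; split=> [[ys /evals_consE[y [ys' [->]]]]|->].
  by move/(Hq _ _ sa) => -> /Ha -> /Hp; apply; rewrite /= sa.
exists (f a :: a); last by apply/Hp; rewrite /= ?sa.
by apply/evals_consE; exists (f a), a; split=> //; [apply/(Hq _ _ sa)|apply/Ha].
Qed.

Create HintDb computability.
Ltac computability := rewrite /recursive1 /recursive2 /recursive3 /=; auto 100 with computability nocore.

Lemma computable_head n : computable n (fun a => head 0 a).
Proof. by apply: (eq_computable _ (computable_proj n 0)) => -[]. Qed.
#[local] Hint Resolve computable_proj computable_head computable_const computable_succ : computability.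

Lemma computable_iter n (e f g : seq nat -> nat) h :
  recursive2 h -> computable n e -> computable n f -> computable n g ->
  computable n (fun a => iter (f a) (h (e a)) (g a)).
Proof.
move=> ch ce cf cg; suff c3 : recursive3 (fun e k x => iter k (h e) x).
  exact: (computable_comp3 c3).
have ch0 : computable 5 (fun b => h (nth 0 b 2) (nth 0 b 1)).
  by apply: computable_comp2 => //; computability.
have [p Hp] := computable_iteri (computable_proj 3 1) (computable_proj 3 2) ch0.
exists p => O a sa v; rewrite (Hp O a sa) /=.
set k := nth 0 a 1; suff -> : iteri k (fun _ w => h (nth 0 a 0) w) (nth 0 a 2) =
  iter k (h (nth 0 a 0)) (nth 0 a 2) by [].
by elim: k => //= k ->.
Qed.

(** * Arithmetic and boolean functions *)

Lemma recursive2_addn : recursive2 addn.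
Proof.
have := @computable_iteri 2 _ (fun b => (nth 0 b 1).+1) _ (computable_proj _ 0) (computable_proj _ 1).
case; first by computability.
move=> p Hp; exists p => O a sa v; rewrite (Hp O a sa) /=.
suff E x y : iteri x (fun=> succn) y = x + y by rewrite E.
by elim: x => //= x ->.
Qed.

Lemma computable_add n f g : computable n f -> computable n g -> computable n (fun a => f a + g a).
Proof. exact: computable_comp2 recursive2_addn. Qed.
#[local] Hint Resolve computable_add : computability.

Lemma recursive1_predn : recursive1 predn.
Proof.
have := @computable_iteri 1 _ (fun b => nth 0 b 0) _ (computable_proj _ 0) (computable_const _ 0).
case; first by computability.
by move=> p Hp; exists p => O [|x a] sa v; rewrite (Hp O _ sa) {sa} //=; case: x.
Qed.

Lemma computable_pred n f : computable n f -> computable n (fun a => (f a).-1).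
Proof. exact: computable_comp recursive1_predn. Qed.
#[local] Hint Resolve computable_pred : computability.

Lemma recursive2_subn : recursive2 subn.
Proof.
have := @computable_iteri 2 _ (fun b => (nth 0 b 1).-1) _ (computable_proj _ 1) (computable_proj _ 0).
case; first by computability.
move=> p Hp; exists p => O a sa v; rewrite (Hp O a sa) /=.
suff E x y : iteri y (fun=> predn) x = x - y by rewrite E.
by elim: y => //= [|y ->]; lia.
Qed.

Lemma computable_sub n f g : computable n f -> computable n g -> computable n (fun a => f a - g a).
Proof. exact: computable_comp2 recursive2_subn. Qed.
#[local] Hint Resolve computable_sub : computability.

Lemma recursive1_odd : recursive1 odd.
Proof.
have := @computable_iteri 1 _ (fun b => 1 - nth 0 b 1) _ (computable_proj _ 0) (computable_const _ 0).
case; first by computability.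
move=> p Hp; exists p => O [|x a] sa v; rewrite (Hp O _ sa) {sa} //=.
suff E : iteri x (fun=> subn 1) 0 = odd x by rewrite E.
by elim: x => //= x ->; case: odd.
Qed.

Lemma recursive1_half : recursive1 half.
Proof.
have := @computable_iteri 1 _ (fun b => odd (nth 0 b 0) + nth 0 b 1) _ (computable_proj _ 0) (computable_const _ 0).
case; first by apply: computable_add; [apply: (computable_comp recursive1_odd)|]; computability.
move=> p Hp; exists p => O [|x a] sa v; rewrite (Hp O _ sa) {sa} //=.
suff E : iteri x (fun i => addn (odd i)) 0 = x./2 by rewrite E.
by elim: x => // x IH; rewrite /= IH -uphalf_half.
Qed.

Lemma computable_half n f : computable n f -> computable n (fun a => (f a)./2).
Proof. exact: computable_comp recursive1_half. Qed.

Lemma computable_double n f : computable n f -> computable n (fun a => (f a).*2).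
Proof.
move=> cf; apply: (@eq_computable _ (fun a => f a + f a)); last by computability.
by move=> a; rewrite addnn.
Qed.
#[local] Hint Resolve computable_half computable_double : computability.

Definition computableb n (b : seq nat -> bool) := computable n (fun a => b a : nat).

Lemma computableb_id n (b : seq nat -> bool) : computable n (fun a => b a : nat) -> computableb n b.
Proof. by []. Qed.
#[local] Hint Resolve computableb_id : computability.

Lemma computable_if n (b : seq nat -> bool) f g : computableb n b -> computable n f -> computable n g ->
  computable n (fun a => if b a then f a else g a).
Proof.
move=> cb cf cg; suff c3 : recursive3 (fun c x y => if c == 0 then y else x).
  have := computable_comp3 c3 cb cf cg; apply: eq_computable => a.
  by case: (b a).
(* Here [b] is [[:: i; w; c; x; y]]: the iteration starts at [y], and every step discards [w] and
   returns [x]. *)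
have := @computable_iteri 3 _ (fun b => nth 0 b 3) _ (computable_proj _ 0) (computable_proj _ 2).
case; first by computability.
move=> p Hp; exists p => O a sa v; rewrite (Hp O a sa) /=.
by case: (nth 0 a 0) => [|k] //; rewrite eqn0Ngt.
Qed.

Lemma computable_odd n f : computable n f -> computable n (fun a => odd (f a)).
Proof. exact: computable_comp recursive1_odd. Qed.
#[local] Hint Resolve computable_if computable_odd : computability.

Lemma computable_neg n (b : seq nat -> bool) :
  computable n (fun a => b a) -> computable n (fun a => ~~ b a).
Proof.
move=> cb; apply: (@eq_computable _ (fun a => 1 - b a)); last by computability.
by move=> a; case: (b a).
Qed.

Lemma computable_and n (b c : seq nat -> bool) :
  computable n (fun a => b a) -> computable n (fun a => c a) -> computable n (fun a => b a && c a).
Proof.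
move=> cb cc; apply: (@eq_computable _ (fun a => if b a then (c a : nat) else 0)).
  by move=> a; case: (b a).
by computability.
Qed.

Lemma computable_leq n f g : computable n f -> computable n g -> computable n (fun a => f a <= g a).
Proof.
move=> cf cg; apply: (@eq_computable _ (fun a => 1 - (f a - g a))); last by computability.
by move=> a; rewrite -subn_eq0; case: (f a - g a).
Qed.
#[local] Hint Resolve computable_neg computable_and computable_leq : computability.

Lemma computable_eqn n f g : computable n f -> computable n g -> computable n (fun a => f a == g a).
Proof.
move=> cf cg; apply: (@eq_computable _ (fun a => (f a <= g a) && (g a <= f a))).
  by move=> a; rewrite eqn_leq.
by computability.
Qed.
#[local] Hint Resolve computable_eqn : computability.

Lemma recursive1_exp2 : recursive1 (expn 2).
Proof.
have := @computable_iteri 1 _ (fun b => nth 0 b 1 + nth 0 b 1) _ (computable_proj _ 0) (computable_const _ 1).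
case; first by computability.
move=> p Hp; exists p => O [|x a] sa v; rewrite (Hp O _ sa) {sa} //=.
suff E : iteri x (fun _ w => w + w) 1 = 2 ^ x by rewrite E.
by elim: x => // x IH; rewrite /= IH expnS mul2n addnn.
Qed.

(** The boolean behind the canonical finite sets: [D u x] is convertible to the truth of
    [bit u x]. *)
Definition bit u x := odd (u %/ 2 ^ x).

Lemma recursive2_bit : recursive2 bit.
Proof.
have := @computable_iteri 2 _ (fun b => (nth 0 b 1)./2) _ (computable_proj _ 1) (computable_proj _ 0).
case; first by computability.
move=> p Hp; apply: computable_odd; exists p => O a sa v; rewrite (Hp O a sa) /=.
suff E x y : iteri y (fun=> half) x = x %/ 2 ^ y by rewrite E.
by elim: y => /= [|y ->]; rewrite ?divn1 // expnSr divnMA divn2.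
Qed.

Definition ins x u := if bit u x then u else u + 2 ^ x.

Lemma computable_exp2 n f : computable n f -> computable n (fun a => 2 ^ f a).
Proof. exact: computable_comp recursive1_exp2. Qed.
Lemma computable_bit n f g : computable n f -> computable n g -> computable n (fun a => bit (f a) (g a)).
Proof. by move=> cf cg; apply: (computable_comp2 recursive2_bit). Qed.
#[local] Hint Resolve computable_exp2 computable_bit : computability.
Lemma computable_ins n f g : computable n f -> computable n g -> computable n (fun a => ins (f a) (g a)).
Proof. by move=> cf cg; rewrite /ins; computability. Qed.
#[local] Hint Resolve computable_ins : computability.

(** * Cantor pairing and its inverse functions *)

Definition tri s := (s * s.+1) %/ 2.

Lemma triS s : tri s.+1 = tri s + s.+1.
Proof. by rewrite /tri addnC -divnMDl //; congr (_ %/ 2); lia. Qed.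

Lemma cpairE n u : cpair n u = tri (n + u) + u.
Proof. by []. Qed.

Lemma recursive1_tri : recursive1 tri.
Proof.
have := @computable_iteri 1 _ (fun b => nth 0 b 1 + (nth 0 b 0).+1) _ (computable_proj _ 0) (computable_const _ 0).
case; first by computability.
move=> p Hp; exists p => O [|x a] sa v; rewrite (Hp O _ sa) {sa} //=.
suff E : iteri x (fun i w => w + i.+1) 0 = tri x by rewrite E.
by elim: x => // x IH; rewrite /= IH triS.
Qed.

Lemma computable_tri n f : computable n f -> computable n (fun a => tri (f a)).
Proof. exact: computable_comp recursive1_tri. Qed.
#[local] Hint Resolve computable_tri : computability.

Lemma computable_cpair n f g : computable n f -> computable n g -> computable n (fun a => cpair (f a) (g a)).
Proof. by move=> cf cg; apply: (@eq_computable _ (fun a => tri (f a + g a) + g a)); last by computability. Qed.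

(** The index of the antidiagonal that contains [k], that is the largest [s] with [tri s <= k],
    found by scanning the numbers up to [k]. *)
Definition diag k := iteri k (fun i w => w + (tri w.+1 <= i.+1)) 0.
Definition pr2 k := k - tri (diag k).
Definition pr1 k := diag k - pr2 k.

(** Every antidiagonal is nonempty, so a step from [k] to [k.+1] enters at most one new
    antidiagonal. *)
Lemma diagP k : tri (diag k) <= k < tri (diag k).+1.
Proof.
elim: k => // k; rewrite /= -/(diag k); move: (diag k) => s.
by have := triS s; have := triS s.+1; case: (leqP (tri s.+1) k.+1) => /=; rewrite ?addn0 ?addn1; lia.
Qed.

Lemma diag_cpair a b : diag (cpair a b) = a + b.
Proof.
have := diagP (cpair a b); rewrite cpairE; move: (diag _) => s.
have mono x y : x < y -> tri x + x < tri y.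
  elim: y => // y IH; rewrite ltnS leq_eqVlt triS => /orP[/eqP -> | /IH]; lia.
case: (ltngtP s (a + b)) => // [/mono | /mono]; rewrite ?triS; lia.
Qed.

Lemma pr2_cpair a b : pr2 (cpair a b) = b.
Proof. by rewrite /pr2 diag_cpair cpairE addKn. Qed.

Lemma pr1_cpair a b : pr1 (cpair a b) = a.
Proof. by rewrite /pr1 pr2_cpair diag_cpair addnK. Qed.

Lemma cpair_pr k : cpair (pr1 k) (pr2 k) = k.
Proof. by have := diagP k; rewrite cpairE /pr1 /pr2 triS => H; rewrite subnK ?subnKC; lia. Qed.

Lemma cpair_inj a b c d : cpair a b = cpair c d -> a = c /\ b = d.
Proof. by move=> E; rewrite -(pr1_cpair a b) -{2}(pr2_cpair a b) E pr1_cpair pr2_cpair. Qed.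

Lemma cpair_ge2 a b : b <= cpair a b.
Proof. by rewrite cpairE leq_addl. Qed.

Lemma cpair00 : cpair 0 0 = 0.
Proof. by []. Qed.

Lemma recursive1_diag : recursive1 diag.
Proof.
have := @computable_iteri 1 _ (fun b => nth 0 b 1 + (tri (nth 0 b 1).+1 <= (nth 0 b 0).+1)) _
  (computable_proj _ 0) (computable_const _ 0).
case; first by computability.
by move=> p Hp; exists p => O [|x a] sa v; rewrite (Hp O _ sa).
Qed.

Lemma computable_diag n f : computable n f -> computable n (fun a => diag (f a)).
Proof. exact: computable_comp recursive1_diag. Qed.
#[local] Hint Resolve computable_diag computable_cpair : computability.

Lemma computable_pr2 n f : computable n f -> computable n (fun a => pr2 (f a)).
Proof. by move=> cf; rewrite /pr2; computability. Qed.
#[local] Hint Resolve computable_pr2 : computability.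
Lemma computable_pr1 n f : computable n f -> computable n (fun a => pr1 (f a)).
Proof. by move=> cf; rewrite /pr1; computability. Qed.
#[local] Hint Resolve computable_pr1 : computability.

(** * Lists and finite sets *)

(** The successor leaves 0 free for the empty list, so that lists and numbers correspond
    bijectively. *)
Definition ccons x s := (cpair x s).+1.
Definition chead k := pr1 k.-1.
Definition ctail k := pr2 k.-1.
Definition cseq := foldr ccons 0.

Fixpoint dseq_rec fuel k :=
  if fuel is fuel'.+1 then
    if k is k'.+1 then pr1 k' :: dseq_rec fuel' (pr2 k') else [::]
  else [::].
Definition dseq k := dseq_rec k k.

Lemma pr2_le k : pr2 k <= k.
Proof. by rewrite -{2}(cpair_pr k) cpair_ge2. Qed.

Lemma dseq_recE fuel k : k <= fuel -> dseq_rec fuel k = dseq k.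
Proof.
rewrite /dseq; elim: fuel {-2}fuel (leqnn fuel) k => [|N IH] [|fuel] leN [|k] //= lek.
by congr cons; rewrite !IH //; have := pr2_le k; lia.
Qed.

Lemma dseq_cons x s : dseq (ccons x s) = x :: dseq s.
Proof. by rewrite /dseq /= pr1_cpair pr2_cpair dseq_recE // cpair_ge2. Qed.

Lemma ccons_surj k : 0 < k -> k = ccons (chead k) (ctail k).
Proof. by case: k => // k _; rewrite /ccons cpair_pr. Qed.

Lemma cseqK : cancel cseq dseq.
Proof. by elim=> //= x s IH; rewrite dseq_cons IH. Qed.

Lemma dseqK : cancel dseq cseq.
Proof.
move=> k; elim: k {-2}k (leqnn k) => [|N IH] k leN; first by case: k leN.
case: (posnP k) => [->|] // /ccons_surj kE; rewrite {1}kE dseq_cons /= IH -?kE //.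
by rewrite /ctail; have := pr2_le k.-1; have := kE; rewrite /ccons; lia.
Qed.

Lemma chead_cons x s : chead (ccons x s) = x. Proof. exact: pr1_cpair. Qed.
Lemma ctail_cons x s : ctail (ccons x s) = s. Proof. exact: pr2_cpair. Qed.

Lemma cheadE k : chead k = head 0 (dseq k).
Proof. by case: k => // k; rewrite (ccons_surj (ltn0Sn k)) chead_cons dseq_cons. Qed.

Lemma ctailE k : dseq (ctail k) = behead (dseq k).
Proof. by case: k => // k; rewrite (ccons_surj (ltn0Sn k)) ctail_cons dseq_cons. Qed.

Lemma size_dseq k : size (dseq k) <= k.
Proof.
by rewrite -{2}(dseqK k); elim: (dseq k) => //= x s IH; rewrite /ccons ltnS (leq_trans IH) ?cpair_ge2.
Qed.

Lemma computable_ccons n f g : computable n f -> computable n g -> computable n (fun a => ccons (f a) (g a)).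
Proof. by move=> cf cg; rewrite /ccons; computability. Qed.
Lemma computable_chead n f : computable n f -> computable n (fun a => chead (f a)).
Proof. by move=> cf; rewrite /chead; computability. Qed.
Lemma computable_ctail n f : computable n f -> computable n (fun a => ctail (f a)).
Proof. by move=> cf; rewrite /ctail; computability. Qed.
#[local] Hint Resolve computable_ccons computable_chead computable_ctail : computability.

Lemma computable_nth_dseq n f g : computable n f -> computable n g ->
  computable n (fun a => nth 0 (dseq (f a)) (g a)).
Proof.
move=> cf cg; apply: (@eq_computable _ (fun a => chead (iter (g a) ctail (f a)))).
  move=> a; rewrite cheadE -nth0; move: (f a) (g a) => k i.
  by elim: i k => [|i IH] k //; rewrite iterSr IH ctailE nth_behead.
apply: computable_chead; apply: (@computable_iter _ (fun _ => 0) _ _ (fun _ => ctail)) => //; computability.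
Qed.
#[local] Hint Resolve computable_nth_dseq : computability.

Lemma computable_foldl n f z G : recursive2 G -> computable n z -> computable n f ->
  computable n (fun a => foldl G (z a) (dseq (f a))).
Proof.
move=> cG cz cf.
(* The state pairs the accumulator with the unread part of the list. A finished state is a fixed
   point, so it does no harm to iterate [f a] times, the code being a bound on the length. *)
pose step (_ st : nat) := if pr2 st == 0 then st else
  cpair (G (pr1 st) (chead (pr2 st))) (ctail (pr2 st)).
apply: (@eq_computable _ (fun a => pr1 (iter (f a) (step 0) (cpair (z a) (f a))))).
  move=> a; move: (z a) (f a) => x s.
  suff H k y t : size (dseq t) <= k ->
      pr1 (iter k (step 0) (cpair y t)) = foldl G y (dseq t) by rewrite H ?size_dseq.
  elim: k y t => [|k IH] y t; first by rewrite leqn0 => /nilP -> /=; rewrite pr1_cpair.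
  rewrite iterSr {2}/step pr1_cpair pr2_cpair; case: posnP => [-> _|]; first exact: IH.
  by move/ccons_surj => ->; rewrite chead_cons ctail_cons dseq_cons => /IH.
apply: computable_pr1; apply: (@computable_iter _ (fun _ => 0) _ _ step); try by computability.
rewrite /step /recursive2; apply: computable_if; try by computability.
by apply: computable_cpair; [apply: (computable_comp2 cG)|]; computability.
Qed.

Lemma bit0 x : bit 0 x = false.
Proof. by rewrite /bit div0n. Qed.

Lemma bit_ltn u x : bit u x -> x < u.
Proof.
move=> H; rewrite ltnNge; apply/negP => le; move: H.
by rewrite /bit divn_small // (leq_ltn_trans le) // ltn_expl.
Qed.

(** Adding [2 ^ x] when bit [x] is 0 causes no carry: below [x] the quotient changes by an even
    number, and above [x] the unit added to an even quotient is lost by halving. *)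
Lemma bit_ins x u y : bit (ins x u) y = (y == x) || bit u y.
Proof.
rewrite /ins; case: ifPn => [Hx|]; first by case: eqP => [->|_]; rewrite ?Hx ?orFb.
have pos m : 0 < 2 ^ m by rewrite expn_gt0.
rewrite /bit; case: ltngtP => [lt|gt|->] nx.
- by rewrite -(subnK (ltnW lt)) expnD addnC divnMDl // oddD oddX subn_eq0 leqNgt lt.
- have e w : w %/ 2 ^ y = (w %/ 2 ^ x)./2 %/ 2 ^ (y - x.+1).
    by rewrite -divn2 -!divnMA -expnS -expnD -subSn // subSS subnKC // ltnW.
  rewrite !e divnDr // divnn pos addn1 /= uphalf_half; move: nx.
  by case: odd.
- by rewrite divnDr // divnn pos addn1 /= nx.
Qed.

Fixpoint iset (s : seq nat) := if s is x :: s' then ins x (iset s') else 0.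

Lemma bit_iset s y : bit (iset s) y = (y \in s).
Proof. by elim: s => [|x s IH] /=; rewrite ?bit0 // bit_ins IH in_cons. Qed.

(** * Horn clauses *)

Fixpoint prf_to_tree (p : prf) : GenTree.tree nat :=
  match p with
  | PZero => GenTree.Node 0 [::]
  | PSucc => GenTree.Node 1 [::]
  | PProj i => GenTree.Node 2 [:: GenTree.Leaf i]
  | PComp f gs => GenTree.Node 3 (prf_to_tree f :: map prf_to_tree gs)
  | PPrec f g => GenTree.Node 4 [:: prf_to_tree f; prf_to_tree g]
  | PMu f => GenTree.Node 5 [:: prf_to_tree f]
  | POrac => GenTree.Node 6 [::]
  end.

Fixpoint prf_to_treeK (p : prf) : tree_to_prf (prf_to_tree p) = Some p.
Proof.
case: p => //= [f gs|f g|f]; rewrite ?prf_to_treeK //.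
suff -> : all_some (map tree_to_prf (map prf_to_tree gs)) = Some gs by [].
by elim: gs => //= g gs ->; rewrite prf_to_treeK.
Qed.

Lemma decode_surj p : exists e, decode e = p.
Proof. by exists (pickle (prf_to_tree p)); rewrite /decode pickleK /= prf_to_treeK. Qed.

Record clause := Clause {
  guard : seq nat -> bool;
  premises : seq (seq nat -> nat);
  conclusion : seq nat -> nat }.

(** A list of values for the variables of a clause has no fixed length, so computability refers to
    the number coding the list. *)
Definition computable_on_codes (f : seq nat -> nat) := recursive1 (fun k => f (dseq k)).

Record computable_clause (c : clause) : Prop := ComputableClause {
  computable_guard : computable_on_codes (fun e => guard c e);
  computable_premises : forall p, List.In p (premises c) -> computable_on_codes p;
  computable_conclusion : computable_on_codes (conclusion c) }.

(* A fact [x] of the base set is represented by the atom [cpair 0 x]. *)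
Inductive derivable (H : seq clause) (B : nat -> Prop) : nat -> Prop :=
| derivable_fact x : B x -> derivable H B (cpair 0 x)
| derivable_clause c e : List.In c H -> guard c e ->
    (forall p, List.In p (premises c) -> derivable H B (p e)) ->
    derivable H B (conclusion c e).

Lemma derivable_mono H (B B' : nat -> Prop) x :
  (forall y, B y -> B' y) -> derivable H B x -> derivable H B' x.
Proof.
by move=> sub; elim=> [y /sub|c e Hc Hg _ IH]; [apply: derivable_fact|apply: derivable_clause].
Qed.

(** A derivation is a finite tree, hence uses finitely many facts; those of the premises are
    concatenated. *)
Lemma derivable_compact H B x : derivable H B x ->
  exists s : seq nat, (forall y, y \in s -> B y) /\ derivable H (fun y => y \in s) x.
Proof.
elim=> [y By|c e Hc Hg _ IH].
  exists [:: y]; split=> [z|]; first by rewrite inE => /eqP ->.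
  by apply: derivable_fact; rewrite inE.
suff [s [sB Hs]] : exists s : seq nat, (forall y, y \in s -> B y) /\
    forall p, List.In p (premises c) -> derivable H (fun y => y \in s) (p e).
  by exists s; split=> //; apply: derivable_clause.
elim: (premises c) IH => [|p ps IHps] IH; first by exists [::].
have [s1 [sB1 H1]] := IH p (or_introl erefl).
have [|s2 [sB2 H2]] := IHps; first by move=> q Hq; apply: IH; right.
exists (s1 ++ s2); split=> [y|q [<-|/H2]]; first by rewrite mem_cat => /orP[/sB1|/sB2].
  by apply: derivable_mono H1 => y; rewrite mem_cat => ->.
by apply: derivable_mono => y; rewrite mem_cat => ->; rewrite orbT.
Qed.

(** * Computing the derivable atoms in stages *)

Section Run.
Variable H : seq clause.

Definition fire c k s :=
  if guard c (dseq k) && all (fun p : seq nat -> nat => bit s (p (dseq k))) (premises c)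
  then ins (conclusion c (dseq k)) s else s.

(** The number [k] serves twice: as a candidate fact from [D_u], and as the code of a list of values
    at which every clause is tried. *)
Definition stage u k s :=
  foldr (fun c => fire c k) (if bit u k then ins (cpair 0 k) s else s) H.

(* Every instance [k = pr1 i] is tried at infinitely many stages [i]. *)
Definition run u n := iteri n (fun i s => stage u (pr1 i) s) 0.

Lemma computable_fire n c f g : computable_clause c -> computable n f -> computable n g ->
  computable n (fun a => fire c (f a) (g a)).
Proof.
move=> [cg cp cc] cf cgg; rewrite /fire.
apply: computable_if => //; last first.
  by apply: computable_ins => //; apply: (computable_comp cc).
apply: computable_and; first exact: (computable_comp cg).
elim: (premises c) cp => [|p ps IH] cp /=; first exact: computable_const.
apply: computable_and; last by apply: IH => q Hq; apply: cp; right.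
by apply: computable_bit => //; apply: (computable_comp (cp p (or_introl erefl))).
Qed.

Lemma recursive2_run :
  (forall c, List.In c H -> computable_clause c) -> recursive2 run.
Proof.
move=> compH.
have cs : computable 4 (fun b => stage (nth 0 b 2) (pr1 (nth 0 b 0)) (nth 0 b 1)).
  rewrite /stage; elim: H compH => [|c cs IH] cH /=; first by computability.
  apply: computable_fire; [by apply: cH; left | by computability|].
  by apply: IH => d Hd; apply: cH; right.
have [p Hp] := computable_iteri (computable_proj 2 1) (computable_const 2 0) cs.
by exists p => O a sa v; rewrite (Hp O a sa).
Qed.

Lemma bit_fire c k s x : bit s x -> bit (fire c k s) x.
Proof. by rewrite /fire; case: ifP => // _; rewrite bit_ins => ->; rewrite orbT. Qed.

Lemma bit_stage u k s x : bit s x -> bit (stage u k s) x.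
Proof.
rewrite /stage => Hx; elim: H => [|c cs IH] /=; last exact: bit_fire.
by case: ifP => // _; rewrite bit_ins Hx orbT.
Qed.

Lemma bit_run u m n x : m <= n -> bit (run u m) x -> bit (run u n) x.
Proof. by move/subnK <-; elim: (n - m) => // d IH /IH; apply: bit_stage. Qed.

Lemma run_sound u n x : bit (run u n) x -> derivable H (fun y => bit u y) x.
Proof.
elim: n x => [|n IH] x; first by rewrite bit0.
rewrite /run /= -/(run u n) /stage; move: (pr1 n) => k.
(* The induction runs over the list being folded, while derivability keeps referring to all of [H];
   this trivial inclusion is what remains of the link between them. *)
have: forall c, List.In c H -> List.In c H by [].
elim: {1 3}H x => [|c cs IHc] x sub /=.
  case: ifP => Hk; last exact: IH.
  by rewrite bit_ins => /orP[/eqP ->|/IH //]; apply: derivable_fact.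
have {}IHc y := IHc y (fun d Hd => sub d (or_intror Hd)).
rewrite {1}/fire; case: ifP => [/andP[Hg Hp]|_]; last exact: IHc.
rewrite bit_ins => /orP[/eqP ->|/IHc //].
apply: derivable_clause => //; first by apply: sub; left.
elim: (premises c) Hp => [|q qs IHq] //= /andP[Hq Hqs] r [<-|]; first exact: IHc.
exact: IHq.
Qed.

Lemma run_complete u x : derivable H (fun y => bit u y) x -> exists n, bit (run u n) x.
Proof.
elim=> [y By|c e Hc Hg _ IH].
  exists (cpair y 0).+1; rewrite /run /= -/(run u _) pr1_cpair.
  move: (run u _) => s; rewrite /stage; elim: H => [|c cs IH] /=; last exact: bit_fire.
  by rewrite By bit_ins eqxx.
have {IH} [n Hn] : exists n, forall p, List.In p (premises c) -> bit (run u n) (p e).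
  elim: (premises c) IH => [|p ps IHp] IH; first by exists 0.
  have [n1 H1] := IH p (or_introl erefl).
  have [|n2 H2] := IHp; first by move=> q Hq; apply: IH; right.
  exists (maxn n1 n2) => q [<-|/H2]; first exact: bit_run (leq_maxl _ _) H1.
  exact: bit_run (leq_maxr _ _).
(* Stage [cpair (cseq e) n] tries the values [e], and being at least [n] it finds all the premises
   present. *)
exists (cpair (cseq e) n).+1; rewrite /run /= -/(run u _) pr1_cpair.
have {}Hn p : List.In p (premises c) -> bit (run u (cpair (cseq e) n)) (p e).
  by move/Hn; apply: bit_run (cpair_ge2 _ _).
move: (run u _) Hn => s Hn; rewrite /stage.
elim: H Hc => [|d ds IH] //= [->|/IH]; last exact: bit_fire.
set t := foldr _ _ _; have st x0 : bit s x0 -> bit t x0.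
  rewrite /t => Hx; elim: ds {IH t} => [|d' ds IH] /=; last exact: bit_fire.
  by case: ifP => // _; rewrite bit_ins Hx orbT.
rewrite /fire cseqK Hg /=; case: ifPn => [_|]; first by rewrite bit_ins eqxx.
case/negP; elim: (premises c) Hn => [|p ps IHp] //= Hn.
by rewrite (st _ (Hn p (or_introl erefl))); apply: IHp => q Hq; apply: Hn; right.
Qed.

(** The witnessing relation between [x] and [u] is derivability of [h x] from [D_u]. It is c.e. by a
    search for a stage, and compactness makes the finite sets [D_u] suffice. *)
Theorem derivable_le_e B h :
  (forall c, List.In c H -> computable_clause c) -> recursive1 h ->
  le_e (fun x => derivable H B (h x)) B.
Proof.
move=> cH ch; exists (fun x u => derivable H (fun y => bit u y) (h x)); split; last first.
  move=> x; split=> [/derivable_compact[s [sB Hs]]|[u [Hu uB]]].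
    exists (iset s); split; last by move=> y; rewrite -[D _ _]/(is_true (bit _ _)) bit_iset; apply: sB.
    by apply: derivable_mono Hs => y; rewrite bit_iset.
  exact: derivable_mono Hu.
(* The arguments are [[:: n; x; u]]. The bit is negated because [PMu] searches for a zero. *)
have [p Hp] : computable 3 (fun a => ~~ bit (run (nth 0 a 2) (nth 0 a 0)) (h (nth 0 a 1))).
  apply: computable_neg; apply: computable_bit; last exact: (computable_comp ch (computable_proj _ 1)).
  by apply: (computable_comp2 (recursive2_run cH)); computability.
have [e He] := decode_surj (PMu p); exists e => x u; rewrite He; split=> [/run_complete Hn|[n]].
  exists (ex_minn Hn); case: ex_minnP => n Hx nmin; apply/eval_muE.
  split; first by apply/Hp => //=; rewrite Hx.
  move=> m mn; exists 0; apply/Hp => //=.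
  by case: (boolP (bit _ _)) => // /nmin; rewrite leqNgt mn.
case/eval_muE => /(Hp _ [:: n; x; u] erefl) /= Hx _.
by apply: (@run_sound u n); case: (bit _ _) Hx.
Qed.

End Run.

(** * Decoding programs *)

Definition crev s := foldl (fun acc x => ccons x acc) 0 (dseq s).

Lemma dseq_foldl_ccons (s : seq nat) t : dseq (foldl (fun acc x => ccons x acc) t s) = catrev s (dseq t).
Proof. by elim: s t => //= x s IH t; rewrite IH dseq_cons. Qed.

Lemma dseq_crev s : dseq (crev s) = rev (dseq s).
Proof. exact: dseq_foldl_ccons. Qed.

Lemma computable_crev n f : computable n f -> computable n (fun a => crev (f a)).
Proof. by move=> cf; apply: computable_foldl => //; rewrite ?/recursive2; computability. Qed.
#[local] Hint Resolve computable_crev : computability.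

(** The three arguments of [CodeSeq.decode_rec] together with its output so far, latest entry first;
    hence the result comes out reversed. *)
Definition rundec_state v q r acc := cpair v (cpair q (cpair r acc)).

Definition rundec_step (_ st : nat) :=
  let v := pr1 st in let q := pr1 (pr2 st) in
  let r := pr1 (pr2 (pr2 st)) in let acc := pr2 (pr2 (pr2 st)) in
  if q == 0 then st
  else if r == 0 then rundec_state 0 q.-1 q.-1 (ccons v acc)
  else if r == 1 then rundec_state v.+1 q.-1 q.-1 acc
  else rundec_state v q.-1 r.-2 acc.

Definition rundec n := iter n.-1 (rundec_step 0) (rundec_state 0 n.-1 n.-1 0).

Definition revdecode n :=
  if n == 0 then 0 else ccons (pr1 (rundec n)) (pr2 (pr2 (pr2 (rundec n)))).

Lemma dseq_revdecode n : dseq (revdecode n) = rev (CodeSeq.decode n).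
Proof.
rewrite /revdecode /rundec; case: n => //= n; rewrite dseq_cons.
have H q v r acc : let st := iter q (rundec_step 0) (rundec_state v q r acc) in
    pr1 st :: dseq (pr2 (pr2 (pr2 st))) = catrev (CodeSeq.decode_rec v q r) (dseq acc).
  elim: q v r acc => [|q IH] v r acc.
    by rewrite /= /rundec_state !(pr1_cpair, pr2_cpair).
  rewrite iterSr.
  have -> : rundec_step 0 (rundec_state v q.+1 r acc) =
      if r == 0 then rundec_state 0 q q (ccons v acc)
      else if r == 1 then rundec_state v.+1 q q acc else rundec_state v q r.-2 acc.
    by rewrite /rundec_step /rundec_state !(pr1_cpair, pr2_cpair).
  case: r => [|[|r]]; rewrite /= IH //.
  by rewrite dseq_cons.
exact: H.
Qed.

Lemma computable_revdecode n f : computable n f -> computable n (fun a => revdecode (f a)).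
Proof.
move=> cf; have cr : computable n (fun a => rundec (f a)).
  apply: (@computable_iter _ (fun _ => 0) _ _ rundec_step); rewrite /rundec_state; try by computability.
  by rewrite /recursive2 /rundec_step /rundec_state; computability.
by rewrite /revdecode; computability.
Qed.
#[local] Hint Resolve computable_revdecode : computability.

Definition cdecode_seq n := crev (revdecode n).

Lemma dseq_cdecode_seq n : dseq (cdecode_seq n) = CodeSeq.decode n.
Proof. by rewrite dseq_crev dseq_revdecode revK. Qed.

(** A second coding of programs, in which constructors are visible to the pairing functions. The
    clauses for evaluation work on these codes, and [cdecode] below computes them from the indices
    of [decode]. *)
Fixpoint cprf (p : prf) : nat :=
  match p with
  | PZero => cpair 0 0
  | PSucc => cpair 1 0
  | PProj i => cpair 2 i
  | PComp f gs => cpair 3 (cpair (cprf f) (cseq (map cprf gs)))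
  | PPrec f g => cpair 4 (cpair (cprf f) (cprf g))
  | PMu f => cpair 5 (cprf f)
  | POrac => cpair 6 0
  end.

Definition coption T (c : T -> nat) (o : option T) := oapp (succn \o c) 0 o.

(* Of a tree, [decode] only needs the label of a leaf and the program of a node. *)
Definition ctree (t : GenTree.tree nat) : nat :=
  match t with
  | GenTree.Leaf i => cpair 0 i
  | GenTree.Node _ _ => cpair 1 (coption cprf (tree_to_prf t))
  end.
Definition cforest f := cseq (map ctree f).

Definition tree_program v := if pr1 v == 0 then 0 else pr2 v.

Lemma tree_programE t : tree_program (ctree t) = coption cprf (tree_to_prf t).
Proof. by case: t => [i|n f]; rewrite /tree_program /= pr1_cpair ?pr2_cpair. Qed.

(** This is [all_some] on codes: 0 stands for failure and is absorbing, successes are shifted by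
    one, and the reversal turns the left fold into a right fold. *)
Definition call_some vs := foldl (fun acc v =>
    if (acc != 0) && (tree_program v != 0) then (ccons (tree_program v).-1 acc.-1).+1 else 0)
  1 (dseq (crev vs)).

Lemma call_someE f :
  call_some (cforest f) = coption (fun ps => cseq (map cprf ps)) (all_some (map tree_to_prf f)).
Proof.
rewrite /call_some dseq_crev cseqK foldl_rev.
by elim: f => //= t f ->; rewrite tree_programE; case: (tree_to_prf t) => [p|]; case: all_some.
Qed.

(** The tests reproduce the patterns of [tree_to_prf]. For label 3 the operator and its arguments
    are obtained together, by one call of [call_some] on all subtrees. *)
Definition cnode n vs :=
  let v1 := chead vs in let v2 := chead (ctail vs) in
  let p1 := tree_program v1 in let p2 := tree_program v2 in
  let ps := call_some vs in
  let size0 := vs == 0 in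
  let size1 := (vs != 0) && (ctail vs == 0) in
  let size2 := (ctail vs != 0) && (ctail (ctail vs) == 0) in
  cpair 1
   (if n == 0 then if size0 then (cpair 0 0).+1 else 0
    else if n == 1 then if size0 then (cpair 1 0).+1 else 0
    else if n == 2 then if size1 && (pr1 v1 == 0) then (cpair 2 (pr2 v1)).+1 else 0
    else if n == 3 then
      if ~~ size0 && (ps != 0) then (cpair 3 (cpair (chead ps.-1) (ctail ps.-1))).+1 else 0
    else if n == 4 then
      if size2 && ((p1 != 0) && (p2 != 0)) then (cpair 4 (cpair p1.-1 p2.-1)).+1 else 0
    else if n == 5 then if size1 && (p1 != 0) then (cpair 5 p1.-1).+1 else 0
    else if n == 6 then if size0 then (cpair 6 0).+1 else 0
    else 0).

Lemma ccons_eq0 x s : (ccons x s == 0) = false. Proof. by []. Qed.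

Local Opaque cpair.
Lemma ctree_node n f : ctree (GenTree.Node n f) = cnode n (cforest f).
Proof.
rewrite /cnode call_someE.
case: n => [|[|[|[|[|[|[|n]]]]]]] //; congr (cpair 1 _).
- by case: f.
- by case: f.
- case: f => [|[i|n f1] [|t2 f2]]; rewrite /cforest /= ?(chead_cons, ctail_cons, ccons_eq0, pr1_cpair, pr2_cpair) //=.
- case: f => // t f /=; case: (tree_to_prf t) => // p; case: all_some => // ps /=.
  by rewrite chead_cons ctail_cons.
- case: f => [|t1 [|t2 [|t3 f]]]; rewrite /cforest /= ?(chead_cons, ctail_cons, ccons_eq0, tree_programE) //=.
  by case: (tree_to_prf t1) => // p1; case: (tree_to_prf t2).
- case: f => [|t1 [|t2 f]]; rewrite /cforest /= ?(chead_cons, ctail_cons, ccons_eq0, tree_programE) //=.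
  by case: (tree_to_prf t1).
- by case: f.
Qed.

(* The argument [st] codes the pair of stacks handled by [GenTree.decode_step]. *)
Definition cdecode_step st x :=
  let l := cdecode_seq x in
  let da := cdecode_seq (chead l) in
  let db := cdecode_seq (chead (ctail l)) in
  if (ctail l != 0) && (ctail (ctail l) == 0) then
    if db != 0 then cpair (ccons (cpair 0 (chead db)) (pr1 st)) (pr2 st)
    else if da != 0 then
      if chead da == 0 then cpair 0 (ccons (pr1 st) (pr2 st))
      else cpair (ccons (cnode (chead da).-1 (pr1 st)) (chead (pr2 st))) (ctail (pr2 st))
    else st
  else st.

(** A left fold over the reversed list is the right fold of [GenTree.decode]. Every failure ends in
    0, which is [cprf PZero], the default of [decode]. *)
Definition cdecode e := (tree_program (chead (pr1 (foldl cdecode_step 0 (dseq (revdecode e)))))).-1.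

Lemma cseq_eq0 s : (cseq s == 0) = nilp s.
Proof. by case: s. Qed.

Definition cforests (fs : seq (GenTree.tree nat) * seq (seq (GenTree.tree nat))) :=
  cpair (cforest fs.1) (cseq (map cforest fs.2)).

Lemma unpickle_option n : (unpickle n : option (option nat)) = Some (ohead (CodeSeq.decode n)).
Proof.
transitivity (Some (ohead (pmap (@Some nat) (CodeSeq.decode n)))); first by [].
by case: (CodeSeq.decode n).
Qed.

(** An element of a sum is pickled as a pair of options, and a pair as a list code of length two;
    the intermediate equalities unfold these canonical instances by conversion. *)
Lemma unpickle_sum x : (unpickle x : option (nat + nat)) =
  if CodeSeq.decode x is [:: a; b] then
    oapp (some \o inr) (omap inl (ohead (CodeSeq.decode a))) (ohead (CodeSeq.decode b))
  else None.
Proof.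
transitivity (obind (@sum_of_opair nat nat) (unpickle x : option (option nat * option nat)%type)); first by [].
transitivity (obind (@sum_of_opair nat nat) (obind (some \o pair_of_tag) (if CodeSeq.decode x is [:: a; b] then
  obind (fun i => omap (@Tagged (option nat) i (fun _ => option nat)) (unpickle b)) (unpickle a) else None))).
  by [].
case: (CodeSeq.decode x) => [|a [|b [|c s]]] //.
by rewrite !unpickle_option.
Qed.

Lemma cdecode_seqE n : cdecode_seq n = cseq (CodeSeq.decode n).
Proof. by rewrite -dseq_cdecode_seq dseqK. Qed.

Lemma cdecode_stepE fs x : cdecode_step (cforests fs) x =
  cforests (oapp (fun c => GenTree.decode_step c fs) fs (unpickle x : option (nat + nat))).
Proof.
rewrite unpickle_sum /cdecode_step cdecode_seqE /cforests pr1_cpair pr2_cpair.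
case: (CodeSeq.decode x) => [|a [|b [|c s]]];
  rewrite /= ?(chead_cons, ctail_cons, ccons_eq0) //= !cdecode_seqE !cseq_eq0.
case: (CodeSeq.decode b) => [|y sb] /=; last by rewrite chead_cons.
case: (CodeSeq.decode a) => [|n sa] //=; rewrite chead_cons.
case: n => [|n] //=; rewrite -ctree_node.
by case: fs => f [|g gs]; rewrite /= ?(chead_cons, ctail_cons).
Qed.

Lemma cdecodeE e : cdecode e = cprf (decode e).
Proof.
have -> : decode e = odflt PZero (obind tree_to_prf (GenTree.decode
    (pmap (unpickle : nat -> option (nat + nat)) (CodeSeq.decode e)))) by [].
rewrite /cdecode dseq_revdecode foldl_rev.
have -> s : foldr (fun x st => cdecode_step st x) 0 s =
    cforests (foldr (@GenTree.decode_step nat) ([::], [::]) (pmap unpickle s)).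
  elim: s => [|x s IH]; first by rewrite /cforests cpair00.
  rewrite [LHS]/= IH cdecode_stepE.
  set u := (unpickle : nat -> option (nat + nat)).
  by rewrite -[pmap u (x :: s)]/(oapp (cons^~ (pmap u s)) (pmap u s) (u x)); case: (u x).
rewrite /cforests pr1_cpair /GenTree.decode; case: (foldr _ _ _) => -[|t f] gs //=.
by rewrite /cforest /= chead_cons tree_programE; case: (tree_to_prf t).
Qed.

Lemma computable_tree_program n f : computable n f -> computable n (fun a => tree_program (f a)).
Proof. by move=> cf; rewrite /tree_program; computability. Qed.
#[local] Hint Resolve computable_tree_program : computability.

Lemma computable_call_some n f : computable n f -> computable n (fun a => call_some (f a)).
Proof.
move=> cf; apply: computable_foldl; [|exact: computable_const|exact: computable_crev].
by rewrite /recursive2; computability.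
Qed.
#[local] Hint Resolve computable_call_some : computability.

Lemma computable_cnode n f g : computable n f -> computable n g -> computable n (fun a => cnode (f a) (g a)).
Proof. by move=> cf cg; rewrite /cnode; computability. Qed.
#[local] Hint Resolve computable_cnode : computability.

Lemma computable_cdecode_seq n f : computable n f -> computable n (fun a => cdecode_seq (f a)).
Proof. by move=> cf; rewrite /cdecode_seq; computability. Qed.
#[local] Hint Resolve computable_cdecode_seq : computability.

Lemma computable_cdecode n f : computable n f -> computable n (fun a => cdecode (f a)).
Proof.
move=> cf; rewrite /cdecode.
have c2 : recursive2 cdecode_step by rewrite /recursive2 /cdecode_step; computability.
have := computable_foldl c2 (computable_const n 0) (computable_revdecode cf).
by move=> ?; computability.
Qed.
#[local] Hint Resolve computable_cdecode : computability.

(** * Evaluation as a Horn program *)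

Section EvalInd.
Variables (O : pfun) (P : prf -> seq nat -> nat -> Prop) (Q : seq prf -> seq nat -> seq nat -> Prop).
Hypothesis Pzero : forall a, P PZero a 0.
Hypothesis Psucc : forall a, P PSucc a (head 0 a).+1.
Hypothesis Pproj : forall i a, P (PProj i) a (nth 0 a i).
Hypothesis Pcomp : forall f gs a ys v, Q gs a ys -> P f ys v -> P (PComp f gs) a v.
Hypothesis Pprec0 : forall f g a v, P f a v -> P (PPrec f g) (0 :: a) v.
Hypothesis PprecS : forall f g n a w v,
  P (PPrec f g) (n :: a) w -> P g [:: n, w & a] v -> P (PPrec f g) (n.+1 :: a) v.
Hypothesis Pmu : forall f a n,
  P f (n :: a) 0 -> (forall m, m < n -> exists k, P f (m :: a) k.+1) -> P (PMu f) a n.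
Hypothesis Porac : forall a v, O (head 0 a) v -> P POrac a v.
Hypothesis Qnil : forall a, Q [::] a [::].
Hypothesis Qcons : forall g gs a y ys, P g a y -> Q gs a ys -> Q (g :: gs) a (y :: ys).

(* The generated scheme has no induction hypothesis under the existential of [ev_mu]. *)
Fixpoint eval_nested_ind p a v (H : eval O p a v) {struct H} : P p a v :=
  match H with
  | ev_zero a => Pzero a
  | ev_succ a => Psucc a
  | ev_proj i a => Pproj i a
  | ev_comp f gs a ys v H1 H2 => Pcomp (evals_nested_ind H1) (eval_nested_ind H2)
  | ev_prec0 f g a v H1 => Pprec0 g (eval_nested_ind H1)
  | ev_precS f g n a w v H1 H2 => PprecS (eval_nested_ind H1) (eval_nested_ind H2)
  | ev_mu f a n H1 H2 => Pmu (eval_nested_ind H1) (fun m lt =>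
      match H2 m lt with ex_intro k Hk => ex_intro _ k (eval_nested_ind Hk) end)
  | ev_orac a v H1 => Porac H1
  end
with evals_nested_ind gs a ys (H : evals O gs a ys) {struct H} : Q gs a ys :=
  match H with
  | evs_nil a => Qnil a
  | evs_cons g gs a y ys H1 H2 => Qcons (eval_nested_ind H1) (evals_nested_ind H2)
  end.

End EvalInd.

Lemma foldr_andP T (P : T -> Prop) s : foldr (fun x acc => P x /\ acc) True s <-> forall x, List.In x s -> P x.
Proof.
elim: s => [|x s IH] /=; first by split.
split=> [[Px /IH Ps] y [<-|/Ps]|Ps] //; split; first by apply: Ps; left.
by apply/IH => y sy; apply: Ps; right.
Qed.

Lemma derivable_intro H B c e : List.In c H -> guard c e ->
  foldr (fun p acc => derivable H B (p e) /\ acc) True (premises c) ->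
  derivable H B (conclusion c e).
Proof. by move=> Hc Hg /(foldr_andP (fun p => derivable H B (p e))); apply: derivable_clause. Qed.

(** The component [c] names an oracle, and [t] a set, so one program treats many oracles and sets
    simultaneously. The atoms [mu_atom] and [sub_atom] stand for bounded universal statements, which
    Horn clauses can only build up along the bound. Tag 0 is reserved for facts. *)
Definition eval_atom c p a v := cpair 1 (cpair c (cpair p (cpair a v))).
Definition evals_atom c ps a ys := cpair 2 (cpair c (cpair ps (cpair a ys))).
Definition mu_atom c p a n := cpair 3 (cpair c (cpair p (cpair a n))).
Definition oracle_atom c m v := cpair 4 (cpair c (cpair m v)).
Definition mem_atom t x := cpair 5 (cpair t x).
Definition sub_atom t u k := cpair 6 (cpair t (cpair u k)).

Section Holds.
Variables (B : nat -> Prop) (O : nat -> pfun) (S : nat -> nat -> Prop).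

(* [O] interprets a family of oracles and [S] a family of sets. *)
Definition holds (x : nat) : Prop :=
  let c := pr1 (pr2 x) in let d := pr2 (pr2 x) in
  let p := pr1 d in let a := pr1 (pr2 d) in let v := pr2 (pr2 d) in
  match pr1 x with
  | 0 => B (pr2 x)
  | 1 => forall q, p = cprf q -> eval (O c) q (dseq a) v
  | 2 => forall qs, p = cseq (map cprf qs) -> evals (O c) qs (dseq a) (dseq v)
  | 3 => forall q, p = cprf q -> forall m, m < v -> exists k, eval (O c) q (m :: dseq a) k.+1
  | 4 => O c p (pr2 d)
  | 5 => S c d
  | 6 => forall y, y < pr2 d -> bit p y -> S c y
  | _ => True
  end.

Lemma holds_fact x : holds (cpair 0 x) = B x.
Proof. by rewrite /holds !(pr1_cpair, pr2_cpair). Qed.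
Lemma holds_eval c p a v : holds (eval_atom c p a v) =
  forall q, p = cprf q -> eval (O c) q (dseq a) v.
Proof. by rewrite /holds !(pr1_cpair, pr2_cpair). Qed.
Lemma holds_evals c ps a ys : holds (evals_atom c ps a ys) =
  forall qs, ps = cseq (map cprf qs) -> evals (O c) qs (dseq a) (dseq ys).
Proof. by rewrite /holds !(pr1_cpair, pr2_cpair). Qed.
Lemma holds_mu c p a n : holds (mu_atom c p a n) =
  forall q, p = cprf q -> forall m, m < n -> exists k, eval (O c) q (m :: dseq a) k.+1.
Proof. by rewrite /holds !(pr1_cpair, pr2_cpair). Qed.
Lemma holds_oracle c m v : holds (oracle_atom c m v) = O c m v.
Proof. by rewrite /holds !(pr1_cpair, pr2_cpair). Qed.
Lemma holds_mem t x : holds (mem_atom t x) = S t x.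
Proof. by rewrite /holds !(pr1_cpair, pr2_cpair). Qed.
Lemma holds_sub t u k : holds (sub_atom t u k) = forall y, y < k -> bit u y -> S t y.
Proof. by rewrite /holds !(pr1_cpair, pr2_cpair). Qed.
Definition holdsE := (holds_fact, holds_eval, holds_evals, holds_mu, holds_oracle, holds_mem, holds_sub).

Definition sound (c : clause) : Prop := forall e, guard c e ->
  foldr (fun p acc => holds (p e) /\ acc) True (premises c) -> holds (conclusion c e).

Lemma derivable_holds H x : (forall c, List.In c H -> sound c) -> derivable H B x -> holds x.
Proof.
move=> sH; elim=> [y By|c e Hc Hg _ IH]; first by rewrite holdsE.
by apply: sH => //; apply/(foldr_andP (fun p => holds (p e))).
Qed.

End Holds.

Local Notation var i e := (nth 0 e i).

Definition zero_clause := Clause xpredT [::] (fun e => eval_atom (var 0 e) (cprf PZero) (var 1 e) 0).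
Definition succ_clause := Clause xpredT [::]
  (fun e => eval_atom (var 0 e) (cprf PSucc) (var 1 e) (chead (var 1 e)).+1).
Definition proj_clause := Clause xpredT [::]
  (fun e => eval_atom (var 0 e) (cpair 2 (var 2 e)) (var 1 e) (nth 0 (dseq (var 1 e)) (var 2 e))).
Definition comp_clause := Clause xpredT
  [:: (fun e => evals_atom (var 0 e) (var 1 e) (var 2 e) (var 3 e));
      (fun e => eval_atom (var 0 e) (var 4 e) (var 3 e) (var 5 e))]
  (fun e => eval_atom (var 0 e) (cpair 3 (cpair (var 4 e) (var 1 e))) (var 2 e) (var 5 e)).
Definition nil_clause := Clause xpredT [::] (fun e => evals_atom (var 0 e) 0 (var 1 e) 0).
Definition cons_clause := Clause xpredT
  [:: (fun e => eval_atom (var 0 e) (var 1 e) (var 2 e) (var 3 e));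
      (fun e => evals_atom (var 0 e) (var 4 e) (var 2 e) (var 5 e))]
  (fun e => evals_atom (var 0 e) (ccons (var 1 e) (var 4 e)) (var 2 e) (ccons (var 3 e) (var 5 e))).
Definition prec0_clause := Clause xpredT
  [:: (fun e => eval_atom (var 0 e) (var 1 e) (var 2 e) (var 3 e))]
  (fun e => eval_atom (var 0 e) (cpair 4 (cpair (var 1 e) (var 4 e))) (ccons 0 (var 2 e)) (var 3 e)).
Definition precS_clause := Clause xpredT
  [:: (fun e => eval_atom (var 0 e) (cpair 4 (cpair (var 1 e) (var 4 e)))
                          (ccons (var 5 e) (var 2 e)) (var 6 e));
      (fun e => eval_atom (var 0 e) (var 4 e) (ccons (var 5 e) (ccons (var 6 e) (var 2 e))) (var 3 e))]
  (fun e => eval_atom (var 0 e) (cpair 4 (cpair (var 1 e) (var 4 e)))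
                      (ccons (var 5 e).+1 (var 2 e)) (var 3 e)).
Definition mu_clause := Clause xpredT
  [:: (fun e => mu_atom (var 0 e) (var 1 e) (var 2 e) (var 3 e));
      (fun e => eval_atom (var 0 e) (var 1 e) (ccons (var 3 e) (var 2 e)) 0)]
  (fun e => eval_atom (var 0 e) (cpair 5 (var 1 e)) (var 2 e) (var 3 e)).
Definition mu0_clause := Clause xpredT [::] (fun e => mu_atom (var 0 e) (var 1 e) (var 2 e) 0).
Definition muS_clause := Clause xpredT
  [:: (fun e => mu_atom (var 0 e) (var 1 e) (var 2 e) (var 3 e));
      (fun e => eval_atom (var 0 e) (var 1 e) (ccons (var 3 e) (var 2 e)) (var 4 e).+1)]
  (fun e => mu_atom (var 0 e) (var 1 e) (var 2 e) (var 3 e).+1).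
Definition orac_clause := Clause xpredT
  [:: (fun e => oracle_atom (var 0 e) (chead (var 1 e)) (var 2 e))]
  (fun e => eval_atom (var 0 e) (cprf POrac) (var 1 e) (var 2 e)).
Definition sub0_clause := Clause xpredT [::] (fun e => sub_atom (var 0 e) (var 1 e) 0).
Definition sub_skip_clause := Clause (fun e => ~~ bit (var 1 e) (var 2 e))
  [:: (fun e => sub_atom (var 0 e) (var 1 e) (var 2 e))]
  (fun e => sub_atom (var 0 e) (var 1 e) (var 2 e).+1).
Definition sub_mem_clause := Clause xpredT
  [:: (fun e => sub_atom (var 0 e) (var 1 e) (var 2 e)); (fun e => mem_atom (var 0 e) (var 2 e))]
  (fun e => sub_atom (var 0 e) (var 1 e) (var 2 e).+1).

Definition base_clauses := [:: zero_clause; succ_clause; proj_clause; comp_clause; nil_clause;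
  cons_clause; prec0_clause; precS_clause; mu_clause; mu0_clause; muS_clause; orac_clause;
  sub0_clause; sub_skip_clause; sub_mem_clause].

Lemma computable_eval_atom n f g h k : computable n f -> computable n g -> computable n h ->
  computable n k -> computable n (fun a => eval_atom (f a) (g a) (h a) (k a)).
Proof. by move=> cf cg ch ck; rewrite /eval_atom; computability. Qed.
Lemma computable_evals_atom n f g h k : computable n f -> computable n g -> computable n h ->
  computable n k -> computable n (fun a => evals_atom (f a) (g a) (h a) (k a)).
Proof. by move=> cf cg ch ck; rewrite /evals_atom; computability. Qed.
Lemma computable_mu_atom n f g h k : computable n f -> computable n g -> computable n h ->
  computable n k -> computable n (fun a => mu_atom (f a) (g a) (h a) (k a)).
Proof. by move=> cf cg ch ck; rewrite /mu_atom; computability. Qed.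
Lemma computable_oracle_atom n f g h : computable n f -> computable n g -> computable n h ->
  computable n (fun a => oracle_atom (f a) (g a) (h a)).
Proof. by move=> cf cg ch; rewrite /oracle_atom; computability. Qed.
Lemma computable_mem_atom n f g : computable n f -> computable n g ->
  computable n (fun a => mem_atom (f a) (g a)).
Proof. by move=> cf cg; rewrite /mem_atom; computability. Qed.
Lemma computable_sub_atom n f g h : computable n f -> computable n g -> computable n h ->
  computable n (fun a => sub_atom (f a) (g a) (h a)).
Proof. by move=> cf cg ch; rewrite /sub_atom; computability. Qed.
#[local] Hint Resolve computable_eval_atom computable_evals_atom computable_mu_atom
  computable_oracle_atom computable_mem_atom computable_sub_atom : computability.

Lemma computable_clause_intro (g : seq nat -> bool) ps h : computable_on_codes g ->
  foldr (fun p acc => computable_on_codes p /\ acc) True ps -> computable_on_codes h ->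
  computable_clause (Clause g ps h).
Proof. by move=> cg /(foldr_andP computable_on_codes) cps ch; split. Qed.

Ltac computable_clauses :=
  apply/(foldr_andP computable_clause); rewrite /=;
  repeat match goal with |- _ /\ _ => split | |- True => exact I end;
  apply: computable_clause_intro; rewrite /computable_on_codes /=;
  repeat match goal with |- _ /\ _ => split | |- True => exact I end;
  computability.

Lemma computable_base_clauses c : List.In c base_clauses -> computable_clause c.
Proof. by move: c; computable_clauses. Qed.

Ltac in_list := repeat match goal with
  | |- List.In ?c (?c :: _) => by left
  | |- List.In _ (_ :: _) => right
  end.

Lemma ccons_inj x s y t : ccons x s = ccons y t -> x = y /\ s = t.
Proof. by case=> /cpair_inj. Qed.

Lemma cprf_zero q : cprf PZero = cprf q -> q = PZero.
Proof. by case: q => [||i|f gs|f g|f|] /= /cpair_inj[]. Qed.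
Lemma cprf_succ q : cprf PSucc = cprf q -> q = PSucc.
Proof. by case: q => [||i|f gs|f g|f|] /= /cpair_inj[]. Qed.
Lemma cprf_orac q : cprf POrac = cprf q -> q = POrac.
Proof. by case: q => [||i|f gs|f g|f|] /= /cpair_inj[]. Qed.
Lemma cprf_proj i q : cpair 2 i = cprf q -> q = PProj i.
Proof. by case: q => [||j|f gs|f g|f|] /= /cpair_inj[] // _ ->. Qed.
Lemma cprf_comp f gs q : cpair 3 (cpair f gs) = cprf q ->
  exists f' gs', [/\ q = PComp f' gs', f = cprf f' & gs = cseq (map cprf gs')].
Proof.
by case: q => [||i|f' gs'|f' g'|f'|] /= /cpair_inj[] // _ /cpair_inj[-> ->]; exists f', gs'.
Qed.
Lemma cprf_prec f g q : cpair 4 (cpair f g) = cprf q ->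
  exists f' g', [/\ q = PPrec f' g', f = cprf f' & g = cprf g'].
Proof.
by case: q => [||i|f' gs'|f' g'|f'|] /= /cpair_inj[] // _ /cpair_inj[-> ->]; exists f', g'.
Qed.
Lemma cprf_mu f q : cpair 5 f = cprf q -> exists2 f', q = PMu f' & f = cprf f'.
Proof. by case: q => [||i|f' gs'|f' g'|f'|] /= /cpair_inj[] // _ ->; exists f'. Qed.

Ltac sound_clauses :=
  match goal with |- forall c, List.In c _ -> sound ?B ?O ?S c =>
    apply/(foldr_andP (sound B O S)); rewrite /=;
    repeat match goal with |- _ /\ _ => split | |- True => exact I end;
    move=> e /=; rewrite !holdsE
  end.

(** An evaluation atom whose program component codes no program holds vacuously. When the conclusion
    does concern a program, inverting [cprf] yields the subprograms to which the premises apply. *)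
Lemma sound_base_clauses B O S c : List.In c base_clauses -> sound B O S c.
Proof.
move: c; sound_clauses.
- by move=> _ _ q /cprf_zero ->; constructor.
- by move=> _ _ q /cprf_succ ->; rewrite cheadE; constructor.
- by move=> _ _ q /cprf_proj ->; constructor.
- move=> _ [H1 [H2 _]] q /cprf_comp[f [gs [-> Ef Egs]]].
  exact: ev_comp (H1 _ Egs) (H2 _ Ef).
- by move=> _ _ [|q qs] //= _; constructor.
- move=> _ [H1 [H2 _]] [|q qs] //= /ccons_inj[E1 E2]; rewrite dseq_cons.
  exact: evs_cons (H1 _ E1) (H2 _ E2).
- move=> _ [H1 _] q /cprf_prec[f [g [-> Ef Eg]]]; rewrite dseq_cons.
  exact: ev_prec0 (H1 _ Ef).
- move=> _ [H1 [H2 _]] q Eq; have [f [g [Efg Ef Eg]]] := cprf_prec Eq; rewrite dseq_cons.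
  move: (H1 _ Eq) (H2 _ Eg); rewrite Efg !dseq_cons.
  exact: ev_precS.
- move=> _ [H1 [H2 _]] q /cprf_mu[f -> Ef].
  by apply: ev_mu (H1 _ Ef); move: (H2 _ Ef); rewrite dseq_cons.
- by [].
- move=> _ [H1 [H2 _]] q Eq m; rewrite ltnS leq_eqVlt => /orP[/eqP ->|]; last exact: H1.
  by move: (H2 _ Eq); rewrite dseq_cons; exists (nth 0 e 4).
- by move=> _ [H _] q /cprf_orac ->; constructor; rewrite -cheadE.
- by [].
- move=> Hg [H _] y; rewrite ltnS leq_eqVlt => /orP[/eqP -> Hy|]; last exact: H.
  by rewrite Hy in Hg.
- by move=> _ [H1 [H2 _]] y; rewrite ltnS leq_eqVlt => /orP[/eqP -> _|]; [|apply: H1].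
Qed.

Section Complete.
Variables (H : seq clause) (B : nat -> Prop).
Hypothesis baseH : forall c, List.In c base_clauses -> List.In c H.

Local Ltac use_clause c e :=
  apply: (@derivable_intro H B c e); [apply: baseH; rewrite /base_clauses; in_list | by [] | rewrite /=; repeat split].

(** Each rule of evaluation is matched by a clause, instantiated at the list of values of its
    variables; for [PMu] the condition below the bound is rebuilt by a second induction. *)
Lemma derivable_eval c (O : pfun) q args v :
  (forall m v, O m v -> derivable H B (oracle_atom c m v)) -> eval O q args v ->
  derivable H B (eval_atom c (cprf q) (cseq args) v).
Proof.
move=> HO; move: q args v.
pose Q gs a ys := derivable H B (evals_atom c (cseq (map cprf gs)) (cseq a) (cseq ys)).
apply: (eval_nested_ind (Q := Q)).
- by move=> a; use_clause zero_clause [:: c; cseq a].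
- by move=> a; rewrite -{2}(cseqK a) -cheadE; use_clause succ_clause [:: c; cseq a].
- by move=> i a; rewrite -{2}(cseqK a); use_clause proj_clause [:: c; cseq a; i].
- move=> f gs a ys v H1 H2.
  by use_clause comp_clause [:: c; cseq (map cprf gs); cseq a; cseq ys; cprf f; v].
- move=> f g a v H1.
  by use_clause prec0_clause [:: c; cprf f; cseq a; v; cprf g].
- move=> f g n a w v H1 H2.
  by use_clause precS_clause [:: c; cprf f; cseq a; v; cprf g; n; w].
- move=> f a n H1 H2; use_clause mu_clause [:: c; cprf f; cseq a; n] => //.
  elim: n {H1} H2 => [|n IH] H2; first by use_clause mu0_clause [:: c; cprf f; cseq a].
  have [k Hk] := H2 n (ltnSn n).
  use_clause muS_clause [:: c; cprf f; cseq a; n; k] => //.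
  by apply: IH => m mn; apply: H2; apply: ltnW.
- by move=> a v /HO Hv; use_clause orac_clause [:: c; cseq a; v]; rewrite cheadE cseqK.
- by move=> a; use_clause nil_clause [:: c; cseq a].
- move=> g gs a y ys H1 H2.
  by use_clause cons_clause [:: c; cprf g; cseq a; y; cseq (map cprf gs); cseq ys].
Qed.

(** Applied below with [k = u], which covers the whole of [D_u] since its elements are less than
    [u]. *)
Lemma derivable_sub t u k : (forall x, x < k -> bit u x -> derivable H B (mem_atom t x)) ->
  derivable H B (sub_atom t u k).
Proof.
elim: k => [|k IH] Hk; first by use_clause sub0_clause [:: t; u].
have {}IH : derivable H B (sub_atom t u k) by apply: IH => x /ltnW; apply: Hk.
case: (boolP (bit u k)) => Hb.
  by use_clause sub_mem_clause [:: t; u; k] => //; apply: Hk.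
by apply: (@derivable_intro H B sub_skip_clause [:: t; u; k]) => //;
  apply: baseH; rewrite /base_clauses; in_list.
Qed.

End Complete.

(** * Enumeration operators *)

Local Notation zero_oracle := (chi (fun _ => False)).

Lemma zero_oracleE m v : zero_oracle m v <-> v = 0.
Proof. by split=> [[[]|[_ ->]]|->] //; right; split=> // -[]. Qed.

(** The enumeration operator of index [e]. *)
Definition enum_op e (A : nat -> Prop) (x : nat) : Prop :=
  exists u, (exists v, eval zero_oracle (decode e) [:: x; u] v) /\ forall y, D u y -> A y.

Lemma le_eP A Y : le_e A Y <-> exists e, forall x, A x <-> enum_op e Y x.
Proof.
split=> [[R [[e He] HA]]|[e He]].
  exists e => x; rewrite HA; split=> -[u [Ru Hu]]; exists u; split=> //; exact/He.
exists (fun x u => exists v, eval zero_oracle (decode e) [:: x; u] v).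
by split; [exists e | exact: He].
Qed.

Definition zero_oracle_clause := Clause xpredT [::] (fun e => oracle_atom (var 0 e) (var 1 e) 0).
Definition fact_clause := Clause xpredT [:: (fun e => cpair 0 (var 0 e))] (fun e => mem_atom 0 (var 0 e)).
Definition enum_op_clause := Clause xpredT
  [:: (fun e => eval_atom 0 (cdecode (var 0 e)) (ccons (var 1 e) (ccons (var 2 e) 0)) (var 3 e));
      (fun e => sub_atom (var 4 e) (var 2 e) (var 2 e))]
  (fun e => mem_atom (ccons (var 0 e) (var 4 e)) (var 1 e)).
Definition iter_enum_program := base_clauses ++ [:: zero_oracle_clause; fact_clause; enum_op_clause].

Lemma In_catl T (x : T) s t : List.In x s -> List.In x (s ++ t).
Proof. by move=> sx; apply/List.in_or_app; left. Qed.
Lemma In_catr T (x : T) s t : List.In x t -> List.In x (s ++ t).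
Proof. by move=> sx; apply/List.in_or_app; right. Qed.
Lemma In_cat_ind T (P : T -> Prop) s t : (forall x, List.In x s -> P x) -> (forall x, List.In x t -> P x) ->
  forall x, List.In x (s ++ t) -> P x.
Proof. by move=> Hs Ht x Hx; case: (List.in_app_or _ _ _ Hx) => [/Hs|/Ht]. Qed.

(** Sets are named by the list of operators that produce them from [Y], the outermost first. Lists
    of length two give transitivity of [le_e], and lists of length one a universal operator. *)
Lemma iter_enum_derivable Y l x :
  derivable iter_enum_program Y (mem_atom (cseq l) x) <-> foldr enum_op Y l x.
Proof.
split=> [Hd|].
  rewrite -(cseqK l) -(holds_mem Y (fun _ => zero_oracle) (fun t => foldr enum_op Y (dseq t))).
  apply: derivable_holds Hd; apply: In_cat_ind; first exact: sound_base_clauses.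
  sound_clauses.
  - by move=> _ _; apply/zero_oracleE.
  - by move=> _ [].
  - move=> _ [H1 [H2 _]]; rewrite dseq_cons; exists (nth 0 e 2); split.
      by exists (nth 0 e 3); move: (H1 _ (cdecodeE _)); rewrite !dseq_cons.
    by move=> y Dy; apply: H2 => //; apply: bit_ltn.
elim: l x => [|e l IH] x /=.
  move=> Yx; apply: (@derivable_intro _ _ fact_clause [:: x]) => //; last by split=> //; apply: derivable_fact.
  by rewrite /iter_enum_program; apply: In_catr; in_list.
case=> u [[v Hv] Hu].
apply: (@derivable_intro _ _ enum_op_clause [:: e; x; u; v; cseq l]) => //.
  by rewrite /iter_enum_program; apply: In_catr; in_list.
split; last split=> //=.
  rewrite /= cdecodeE; apply: (@derivable_eval _ _ _ 0 zero_oracle (decode e) [:: x; u] v) => //.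
    by move=> c; apply: In_catl.
  move=> m w /zero_oracleE ->; apply: (@derivable_intro _ _ zero_oracle_clause [:: 0; m]) => //.
  by rewrite /iter_enum_program; apply: In_catr; in_list.
apply: derivable_sub => [c|y _ /Hu /IH //].
exact: In_catl.
Qed.

Lemma iter_enum_le_e Y s h : recursive1 s -> recursive1 h ->
  le_e (fun x => foldr enum_op Y (dseq (s x)) (h x)) Y.
Proof.
move=> cs ch; have ca : recursive1 (fun x => mem_atom (s x) (h x)) by apply: computable_mem_atom.
suff cH c : List.In c iter_enum_program -> computable_clause c.
  have [R [cR HR]] := derivable_le_e Y cH ca; exists R; split=> // x.
  by rewrite -HR -iter_enum_derivable dseqK.
by move: c; apply: In_cat_ind; [apply: computable_base_clauses|computable_clauses].
Qed.

Lemma le_e_trans A B C : le_e A B -> le_e B C -> le_e A C.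
Proof.
move=> /le_eP[e1 He1] /le_eP[e2 He2].
have cs : recursive1 (fun _ => cseq [:: e1; e2]) by exact: computable_const.
have [R [cR HR]] := @iter_enum_le_e C _ id cs (computable_head 1).
exists R; split=> // x; rewrite -HR cseqK He1 /=.
by split=> -[u [Hu uB]]; exists u; split=> // y /uB /He2.
Qed.

(** Every set enumeration reducible to [Y] is a column of this one, so several such sets can be read
    off a single base set. *)
Definition universal_enum Y z := enum_op (pr1 z) Y (pr2 z).

Lemma universal_enum_le_e Y : le_e (universal_enum Y) Y.
Proof.
have c1 : recursive1 (fun z => ccons (pr1 z) 0) by computability.
have c2 : recursive1 pr2 by computability.
have [R [cR HR]] := iter_enum_le_e Y c1 c2.
by exists R; split=> // x; rewrite -HR dseq_cons.
Qed.

Lemma le_e_universal A Y : le_e A Y -> exists e, forall x, A x <-> universal_enum Y (cpair e x).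
Proof. by case/le_eP => e He; exists e => x; rewrite /universal_enum pr1_cpair pr2_cpair. Qed.

(** * Iterated application in the graph model *)

Section IterApp.
Variables (A0 A1 A2 : nat -> Prop) (a b : nat).

Definition iter_app n := iter n (appG A1) A0.
(** Laid out like [join_compl]: both [2n] and [2n+1] concern the answer of [A2] on the [n]-th
    iterate, the former asking for the point [a], the latter for [b]. *)
Definition iter_app_test m := appG A2 (iter_app m./2) (if odd m then b else a).

Variables (Y : nat -> Prop) (e0 e1 e2 : nat).
Hypothesis He0 : forall x, A0 x <-> Y (cpair e0 x).
Hypothesis He1 : forall x, A1 x <-> Y (cpair e1 x).
Hypothesis He2 : forall x, A2 x <-> Y (cpair e2 x).

Definition base_app_clause := Clause xpredT
  [:: (fun e => cpair 0 (cpair e0 (var 0 e)))] (fun e => mem_atom 1 (var 0 e)).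
Definition iter_app_clause := Clause xpredT
  [:: (fun e => cpair 0 (cpair e1 (cpair (var 0 e) (var 1 e))));
      (fun e => sub_atom (var 2 e).+1 (var 1 e) (var 1 e))]
  (fun e => mem_atom (var 2 e).+2 (var 0 e)).
Definition test_app_clause := Clause xpredT
  [:: (fun e => cpair 0 (cpair e2 (cpair (if odd (var 0 e) then b else a) (var 1 e))));
      (fun e => sub_atom (var 0 e)./2.+1 (var 1 e) (var 1 e))]
  (fun e => mem_atom 0 (var 0 e)).
Definition iter_app_program :=
  base_clauses ++ [:: base_app_clause; iter_app_clause; test_app_clause].

Definition iter_app_family t := if t is n.+1 then iter_app n else iter_app_test.

Lemma iter_app_derivable t x :
  derivable iter_app_program Y (mem_atom t x) <-> iter_app_family t x.
Proof.
split=> [Hd|].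
  rewrite -(holds_mem Y (fun _ => zero_oracle) iter_app_family).
  apply: derivable_holds Hd; apply: In_cat_ind; first exact: sound_base_clauses.
  sound_clauses.
  - by move=> _ [/He0].
  - move=> _ [/He1 H1 [H2 _]]; exists (nth 0 e 1); split=> // y Dy.
    by apply: H2 => //; apply: bit_ltn.
  - move=> _ [/He2 H1 [H2 _]]; exists (nth 0 e 1); split=> // y Dy.
    by apply: H2 => //; apply: bit_ltn.
have sub t' u : (forall y, D u y -> derivable iter_app_program Y (mem_atom t' y)) ->
    derivable iter_app_program Y (sub_atom t' u u).
  by move=> Hu; apply: derivable_sub => [c|y _ /Hu //]; apply: In_catl.
have mem n y : iter_app n y -> derivable iter_app_program Y (mem_atom n.+1 y).
  elim: n y => [|n IH] y.
    move=> /He0 Hy; apply: (@derivable_intro _ _ base_app_clause [:: y]) => //.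
      by rewrite /iter_app_program; apply: In_catr; in_list.
    by split=> //; apply: derivable_fact.
  case=> u [/He1 Hu sD]; apply: (@derivable_intro _ _ iter_app_clause [:: y; u; n]) => //.
    by rewrite /iter_app_program; apply: In_catr; in_list.
  by split; [apply: derivable_fact | split=> //; apply: sub => z /sD /IH].
case: t => [|n]; last exact: mem.
case=> u [/He2 Hu sD]; apply: (@derivable_intro _ _ test_app_clause [:: x; u]) => //.
  by rewrite /iter_app_program; apply: In_catr; in_list.
by split; [apply: derivable_fact | split=> //; apply: sub => z /sD /mem].
Qed.

Lemma iter_app_test_le_e : le_e iter_app_test Y.
Proof.
have ch : recursive1 (mem_atom 0) by apply: computable_mem_atom; computability.
suff cH c : List.In c iter_app_program -> computable_clause c.
  have [R [cR HR]] := derivable_le_e Y cH ch; exists R; split=> // x.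
  by rewrite -HR iter_app_derivable.
by move: c; apply: In_cat_ind; [apply: computable_base_clauses|computable_clauses].
Qed.

End IterApp.

(** * From an embedding to an enumeration *)

Lemma iter_app_test_trans A0 A1 A2 a b Y : le_e A0 Y -> le_e A1 Y -> le_e A2 Y ->
  le_e (iter_app_test A0 A1 A2 a b) Y.
Proof.
move=> /le_e_universal[e0 H0] /le_e_universal[e1 H1] /le_e_universal[e2 H2].
exact: le_e_trans (iter_app_test_le_e a b H0 H1 H2) (universal_enum_le_e Y).
Qed.

Lemma pfun_ext (phi psi : pfun) : (forall n v, phi n v <-> psi n v) -> phi = psi.
Proof.
move=> E; apply: functional_extensionality => n; apply: functional_extensionality => v.
exact: propositional_extensionality.
Qed.

Lemma eval_comp1E O f g x a v : (forall y, eval O g a y <-> y = x) ->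
  eval O (PComp f [:: g]) a v <-> eval O f [:: x] v.
Proof.
move=> Hg; rewrite eval_compE; split=> [[ys /evals_consE[y [ys' [-> /Hg -> /evals_nilE ->]]]]|Hf] //.
exists [:: x] => //; apply/evals_consE; exists x, [::]; split=> //; [exact/Hg|exact/evals_nilE].
Qed.

(** * Numerals and the elements acting on them *)

Definition numeral n : pfun := fun _ v => v = n.

Lemma inB_numeral X n : inB X (numeral n).
Proof.
have [p Hp] := computable_const 1 n; have [e He] := decode_surj p.
by exists e => m v; rewrite /Phi He Hp.
Qed.

Lemma numeral_inj m n : numeral m = numeral n -> m = n.
Proof. by move/(congr1 (fun phi : pfun => phi 0 m)) => E; rewrite -[m = n]/(numeral n 0 m) -E. Qed.

(** Position 1 of the join holds the value at 0 of the right-hand function. *)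
Lemma eval_query1 (phi : pfun) n c a v : computes 1 (fun _ => 1) c -> size a = 1 ->
  eval (pjoin phi (numeral n)) (PComp POrac [:: c]) a v <-> v = n.
Proof. by move=> Hc sa; rewrite (eval_comp1E _ _ (x := 1)) ?eval_oracE // => y; apply: Hc. Qed.

(** Application reads the index of a program at argument 0, so a constant function whose value is an
    index acts as that program. Here the program queries the numeral and applies [f]. *)
Lemma appB_numeral f : recursive1 f ->
  exists e, forall n, appB (numeral e) (numeral n) = numeral (f n).
Proof.
move=> [p Hp]; have [c Hc] := computable_const 1 1.
have [e He] := decode_surj (PComp p [:: PComp POrac [:: c]]); exists e => n.
apply: pfun_ext => m v; have -> : appB (numeral e) (numeral n) m v <->
    Phi e (pjoin (numeral e) (numeral n)) m v by split=> [[_ [-> //]]|]; exists e.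
rewrite /Phi He (eval_comp1E _ _ (x := n)) ?Hp // => y.
exact: eval_query1.
Qed.

(** Argument 0 is taken by the index, so the characteristic function is shifted by one. *)
Definition oracle_test e (X : nat -> Prop) : pfun :=
  fun k v => if k is k'.+1 then chi X k' v else v = e.

Lemma inB_oracle_test e X : inB X (oracle_test e X).
Proof.
have [c Hc] := computable_const 0 e.
have [d Hd] := decode_surj (PPrec c POrac); exists d => k v; rewrite /Phi Hd.
case: k => [|k] /=; first by rewrite eval_prec0E Hc.
rewrite eval_precSE; split=> [Xv|[w _ /eval_oracE //]].
(* The recursion step ignores the previous value and queries the oracle at the counter, but the
   previous value must still be defined. *)
suff [w Hw] : exists w, eval (chi X) (PPrec c POrac) [:: k] w by exists w => //; apply/eval_oracE.
elim: k {Xv} => [|k [w Hw]]; first by exists e; rewrite eval_prec0E Hc.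
have [u Hu] : exists u, chi X k u.
  by case: (classic (X k)) => Xk; [exists 1; left | exists 0; right].
by exists u; rewrite eval_precSE; exists w => //; apply/eval_oracE.
Qed.

Lemma appB_oracle_test : exists e, forall X n,
  appB (oracle_test e X) (numeral n) = (fun _ v => chi X n v).
Proof.
have [c Hc] := computable_const 1 1.
(* In the join, the value of the left-hand function at [n.+1], which is the bit of [X] at [n], sits
   at position [n.+1.*2]. *)
have [p Hp] : recursive1 (fun n => n.+1.*2) by computability.
have [e He] := decode_surj (PComp POrac [:: PComp p [:: PComp POrac [:: c]]]); exists e => X n.
apply: pfun_ext => m v; have -> : appB (oracle_test e X) (numeral n) m v <->
    Phi e (pjoin (oracle_test e X) (numeral n)) m v by split=> [[_ [-> //]]|]; exists e.
rewrite /Phi He (eval_comp1E _ _ (x := n.+1.*2)).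
  by rewrite eval_oracE /pjoin [head _ _]/= odd_double doubleK.
by move=> y; rewrite (eval_comp1E _ _ (x := n)) ?Hp // => z; apply: eval_query1.
Qed.

Lemma chi_true (X : nat -> Prop) n : X n -> (fun _ v => chi X n v) = numeral 1.
Proof. by move=> Xn; apply: pfun_ext => m v; split=> [[[_ ->]|[]]|->] //; left. Qed.

Lemma chi_false (X : nat -> Prop) n : ~ X n -> (fun _ v => chi X n v) = numeral 0.
Proof. by move=> Xn; apply: pfun_ext => m v; split=> [[[]|[_ ->]]|->] //; right. Qed.

Lemma appG_mono A B B' x : (forall y, B y -> B' y) -> appG A B x -> appG A B' x.
Proof. by move=> sub [u [Au uB]]; exists u; split=> // y /uB /sub. Qed.

Section Forward.
Variables (X Y : nat -> Prop) (f : pfun -> nat -> Prop).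
Hypothesis embf : embedding_BG X Y f.

Let g n := f (numeral n).

(* Negation swaps the two sets, so an inclusion between them would be an equality. *)
Lemma numeral_separation m n : m + n = 1 -> exists x, g m x /\ ~ g n x.
Proof.
move=> mn; have [finG finj fapp] := embf.
apply: NNPP => sep; have sub x : g m x -> g n x.
  by move=> gx; apply: NNPP => ngx; apply: sep; exists x.
have [e He] : exists e, forall n, appB (numeral e) (numeral n) = numeral (1 - n).
  by apply: appB_numeral; computability.
have swap k : g (1 - k) = appG (g e) (g k) by rewrite /g -He fapp //; apply: inB_numeral.
suff E : g m = g n by have := numeral_inj (finj _ _ (inB_numeral X m) (inB_numeral X n) E); lia.
apply: functional_extensionality => x; apply: propositional_extensionality; split; first exact: sub.
have -> : n = 1 - m by lia.
rewrite swap => /(appG_mono sub); rewrite -swap.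
by have -> : 1 - n = m by lia.
Qed.

(** The point [a] lies in the image of 1 but not of 0, and [b] in the image of 0 but not of 1. In
    the answer for [n], finding [a] therefore means that [n] is in [X], and finding [b] that it is
    not. *)
Lemma join_compl_le_e : le_e (join_compl X) Y.
Proof.
have [finG finj fapp] := embf.
have [a [a1 a0]] := numeral_separation (erefl : 1 + 0 = 1).
have [b [b0 b1]] := numeral_separation (erefl : 0 + 1 = 1).
have [eS HS] : exists e, forall n, appB (numeral e) (numeral n) = numeral n.+1.
  by apply: appB_numeral; computability.
have [eT HT] := appB_oracle_test.
have itE n : iter_app (g 0) (g eS) n = g n.
  by elim: n => //= n ->; rewrite /g -HS fapp //; apply: inB_numeral.
have testE n x : appG (f (oracle_test eT X)) (g n) x <->
    (X n /\ g 1 x) \/ (~ X n /\ g 0 x).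
  rewrite /g -fapp; [|exact: inB_oracle_test|exact: inB_numeral]; rewrite HT.
  by case: (classic (X n)) => Xn; [rewrite (chi_true Xn) | rewrite (chi_false Xn)]; intuition.
have [R [cR HR]] := iter_app_test_trans a b (finG _ (inB_numeral X 0)) (finG _ (inB_numeral X eS))
  (finG _ (inB_oracle_test eT X)).
exists R; split=> // m; rewrite -HR /iter_app_test -/(g 0) -/(g eS) itE testE /join_compl.
by case: (odd m); intuition.
Qed.

End Forward.

(** * The embedding into the graph model *)

(* Read as an element of an operator, a token can only contribute the point [0]. *)
Definition token n v := cpair 0 (cpair n v).+1.
Definition tokens u : pfun := fun n v => D u (token n v).

(** The last rule passes to another function, so [phi] is an index of the family. For arbitrary [u]
    the finite relation [tokens u] may be multivalued; evaluation makes sense relative to any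
    relation. *)
Inductive graph_set : pfun -> nat -> Prop :=
| graph_zero phi : graph_set phi 0
| graph_token phi n v : phi n v -> graph_set phi (token n v)
| graph_app phi m u : 0 < m -> graph_set (appB phi (tokens u)) m -> graph_set phi (cpair m u).

Lemma token_inj n v n' v' : token n v = token n' v' -> n = n' /\ v = v'.
Proof. by case/cpair_inj => _ [] /cpair_inj. Qed.

(** The three rules produce different numbers: 0 is [cpair 0 0], a token has first component 0 and a
    positive second one, and the last rule requires a positive first component. *)
Lemma graph_set_token phi n v : graph_set phi (token n v) -> phi n v.
Proof.
move Ex : (token n v) => x H; case: H Ex => {phi x} [phi|phi n' v' Hphi|phi m u m0 _].
- by rewrite -cpair00 => /cpair_inj[].
- by case/token_inj => -> ->.
- by case/cpair_inj => Em; rewrite -Em in m0.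
Qed.

Lemma graph_set_cpair phi m u : graph_set phi (cpair m u) -> 0 < m -> graph_set (appB phi (tokens u)) m.
Proof.
move Ex : (cpair m u) => x H; case: H Ex => {phi x} [phi|phi n' v' Hphi|phi m' u' m0 H].
- by rewrite -cpair00 => /cpair_inj[->].
- by case/cpair_inj => ->.
- by case/cpair_inj => -> ->.
Qed.

(** A common form for the elements of the pca, with [C = eq e] and [O = chi X], and for applications
    [appB phi psi], with [C = phi 0] read as a set of indices and [O = pjoin phi psi]. *)
Definition run_fun (C : nat -> Prop) (O : pfun) : pfun := fun n v => exists e, C e /\ Phi e O n v.

(** * Enumerability of [graph_set] *)

Section Nested.
Variables (C : nat -> Prop) (O : pfun).

(** These are the functions met when [graph_set (run_fun C O)] is unfolded: successive applications
    to finite relations, the latest at the head of [l]. Indexing by [l] makes all their graphs one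
    simultaneous least fixed point. *)
Fixpoint nested_app (l : seq nat) : pfun :=
  if l is u :: l' then appB (nested_app l') (tokens u) else run_fun C O.
Definition nested_oracle (l : seq nat) : pfun :=
  if l is u :: l' then pjoin (nested_app l') (tokens u) else O.

Definition run_facts z : Prop :=
  match pr1 z with
  | 0 => C (pr2 z)
  | 1 => O (pr1 (pr2 z)) (pr2 (pr2 z))
  | _ => False
  end.

Definition nested_family t x : Prop :=
  if pr1 t == 0 then nested_app (dseq (pr2 t)) (pr1 x) (pr2 x)
  else graph_set (nested_app (dseq (pr2 t))) x.

End Nested.

Definition fun_atom l n v := mem_atom (cpair 0 l) (cpair n v).
Definition graph_atom l x := mem_atom (cpair 1 l) x.

Lemma computable_token n f g : computable n f -> computable n g ->
  computable n (fun a => token (f a) (g a)).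
Proof. by move=> cf cg; rewrite /token; computability. Qed.
Lemma computable_fun_atom n f g h : computable n f -> computable n g -> computable n h ->
  computable n (fun a => fun_atom (f a) (g a) (h a)).
Proof. by move=> cf cg ch; rewrite /fun_atom; computability. Qed.
Lemma computable_graph_atom n f g : computable n f -> computable n g ->
  computable n (fun a => graph_atom (f a) (g a)).
Proof. by move=> cf cg; rewrite /graph_atom; computability. Qed.
#[local] Hint Resolve computable_token computable_fun_atom computable_graph_atom : computability.

Definition oracle_fact_clause := Clause xpredT
  [:: (fun e => cpair 0 (cpair 1 (cpair (var 0 e) (var 1 e))))]
  (fun e => oracle_atom 0 (var 0 e) (var 1 e)).
Definition oracle_left_clause := Clause (fun e => ~~ odd (var 0 e))
  [:: (fun e => fun_atom (var 1 e) (var 0 e)./2 (var 2 e))]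
  (fun e => oracle_atom (ccons (var 3 e) (var 1 e)) (var 0 e) (var 2 e)).
Definition oracle_right_clause :=
  Clause (fun e => odd (var 0 e) && bit (var 3 e) (token (var 0 e)./2 (var 2 e))) [::]
  (fun e => oracle_atom (ccons (var 3 e) (var 1 e)) (var 0 e) (var 2 e)).
Definition run_clause := Clause xpredT
  [:: (fun e => cpair 0 (cpair 0 (var 0 e)));
      (fun e => eval_atom 0 (cdecode (var 0 e)) (ccons (var 1 e) 0) (var 2 e))]
  (fun e => fun_atom 0 (var 1 e) (var 2 e)).
Definition app_clause := Clause xpredT
  [:: (fun e => fun_atom (var 3 e) 0 (var 0 e));
      (fun e => eval_atom (ccons (var 4 e) (var 3 e)) (cdecode (var 0 e)) (ccons (var 1 e) 0) (var 2 e))]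
  (fun e => fun_atom (ccons (var 4 e) (var 3 e)) (var 1 e) (var 2 e)).
Definition graph_zero_clause := Clause xpredT [::] (fun e => graph_atom (var 0 e) 0).
Definition graph_token_clause := Clause xpredT
  [:: (fun e => fun_atom (var 0 e) (var 1 e) (var 2 e))]
  (fun e => graph_atom (var 0 e) (token (var 1 e) (var 2 e))).
Definition graph_app_clause := Clause (fun e => 0 < var 1 e)
  [:: (fun e => graph_atom (ccons (var 2 e) (var 0 e)) (var 1 e))]
  (fun e => graph_atom (var 0 e) (cpair (var 1 e) (var 2 e))).

Definition graph_program := base_clauses ++ [:: oracle_fact_clause; oracle_left_clause;
  oracle_right_clause; run_clause; app_clause; graph_zero_clause; graph_token_clause;
  graph_app_clause].

Section Derivable.
Variables (C : nat -> Prop) (O : pfun).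

Local Notation holdsG := (holds (run_facts C O) (fun c => nested_oracle C O (dseq c)) (nested_family C O)).

Lemma holds_fun_atom l n v : holdsG (fun_atom l n v) = nested_app C O (dseq l) n v.
Proof. by rewrite holds_mem /nested_family !(pr1_cpair, pr2_cpair). Qed.
Lemma holds_graph_atom l x : holdsG (graph_atom l x) = graph_set (nested_app C O (dseq l)) x.
Proof. by rewrite holds_mem /nested_family !(pr1_cpair, pr2_cpair). Qed.

Lemma run_facts_code e : run_facts C O (cpair 0 e) = C e.
Proof. by rewrite /run_facts pr1_cpair pr2_cpair. Qed.
Lemma run_facts_oracle m v : run_facts C O (cpair 1 (cpair m v)) = O m v.
Proof. by rewrite /run_facts !(pr1_cpair, pr2_cpair). Qed.

Lemma graph_sound x : derivable graph_program (run_facts C O) x -> holdsG x.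
Proof.
apply: derivable_holds; apply: In_cat_ind; first exact: sound_base_clauses.
apply/(foldr_andP (sound _ _ _)); rewrite /=;
  repeat match goal with |- _ /\ _ => split | |- True => exact I end;
  move=> e /=; rewrite ?(holds_fun_atom, holds_graph_atom) ?holdsE.
- by rewrite run_facts_oracle => _ [].
- by move=> /negbTE ev [H _]; rewrite dseq_cons /= /pjoin ev.
- by case/andP=> od Hb _; rewrite dseq_cons /= /pjoin od.
- rewrite run_facts_code => _ [Ce [H _]]; exists (nth 0 e 0); split=> //.
  by move: (H _ (cdecodeE _)); rewrite dseq_cons.
- move=> _ [Ce [H _]]; rewrite dseq_cons; exists (nth 0 e 0); split=> //.
  by move: (H _ (cdecodeE _)); rewrite !dseq_cons.
- by move=> _ _; apply: graph_zero.
- by move=> _ [H _]; apply: graph_token.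
- by move=> m0 [H _]; apply: graph_app => //; rewrite dseq_cons in H.
Qed.

Local Notation derivableG := (derivable graph_program (run_facts C O)).

Local Ltac use_clause c e :=
  apply: (@derivable_intro _ _ c e);
    [by rewrite /graph_program; apply: In_catr; in_list | | rewrite /=; repeat split].

Lemma derivable_Phi l n v e :
  (forall m w, nested_oracle C O l m w -> derivableG (oracle_atom (cseq l) m w)) ->
  Phi e (nested_oracle C O l) n v -> derivableG (eval_atom (cseq l) (cdecode e) (ccons n 0) v).
Proof.
move=> HO He; rewrite cdecodeE; apply: (@derivable_eval _ _ _ _ _ _ [:: n] _ HO) => //.
by move=> c; apply: In_catl.
Qed.

(** The oracle for [u :: l] depends on the function for [l], and the function for [u :: l] on both
    of these, so a single induction proves the two halves in this order. *)
Lemma nested_complete l :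
  (forall m v, nested_oracle C O l m v -> derivableG (oracle_atom (cseq l) m v)) /\
  (forall n v, nested_app C O l n v -> derivableG (fun_atom (cseq l) n v)).
Proof.
elim: l => [|u l [_ IH]].
  have HO m v : O m v -> derivableG (oracle_atom 0 m v).
    move=> Omv; use_clause oracle_fact_clause [:: m; v] => //.
    by apply: derivable_fact; rewrite run_facts_oracle.
  split=> // n v [e [Ce He]]; use_clause run_clause [:: e; n; v] => //.
    by apply: derivable_fact; rewrite run_facts_code.
  exact: (@derivable_Phi [::]).
have HO m v : nested_oracle C O (u :: l) m v -> derivableG (oracle_atom (cseq (u :: l)) m v).
  rewrite /= /pjoin; case: (boolP (odd m)) => [od Hb|ev /IH Hm].
    by use_clause oracle_right_clause [:: m; cseq l; v; u]; rewrite //= od.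
  by use_clause oracle_left_clause [:: m; cseq l; v; u].
split=> // n v [e [/IH Ce He]]; use_clause app_clause [:: e; n; v; cseq l; u] => //.
exact: (@derivable_Phi (u :: l)).
Qed.

Lemma graph_complete l x : graph_set (nested_app C O l) x -> derivableG (graph_atom (cseq l) x).
Proof.
move Ephi : (nested_app C O l) => phi H.
elim: H l Ephi => {phi x} [phi|phi n v Hnv|phi m u m0 _ IH] l Ephi.
- by use_clause graph_zero_clause [:: cseq l].
- use_clause graph_token_clause [:: cseq l; n; v] => //.
  by apply: (nested_complete l).2; rewrite Ephi.
- use_clause graph_app_clause [:: cseq l; m; u] => //.
  by apply: (IH (u :: l)); rewrite /= Ephi.
Qed.

Lemma graph_set_derivable x : graph_set (run_fun C O) x <-> derivableG (graph_atom 0 x).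
Proof.
split=> [/(@graph_complete [::])//|/graph_sound].
by rewrite holds_graph_atom.
Qed.

Lemma graph_set_le_e : le_e (graph_set (run_fun C O)) (run_facts C O).
Proof.
have ch : recursive1 (graph_atom 0) by computability.
suff cH c : List.In c graph_program -> computable_clause c.
  have [R [cR HR]] := derivable_le_e (run_facts C O) cH ch; exists R; split=> // x.
  by rewrite -HR graph_set_derivable.
by move: c; apply: In_cat_ind; [apply: computable_base_clauses|computable_clauses].
Qed.

End Derivable.

(** * Continuity and the homomorphism property *)

Lemma appB_run phi psi : appB phi psi = run_fun (phi 0) (pjoin phi psi).
Proof. by []. Qed.

(** Enlarging [psi] only adds facts to the base set from which the graph is derived. *)
Lemma graph_set_app_mono phi psi psi' x : (forall n v, psi n v -> psi' n v) ->
  graph_set (appB phi psi) x -> graph_set (appB phi psi') x.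
Proof.
move=> sub; rewrite !appB_run !graph_set_derivable; apply: derivable_mono => z.
rewrite /run_facts; case: (pr1 z) => [|[|k]] //.
by rewrite /pjoin; case: odd => // /sub.
Qed.

Lemma graph_set_app_compact phi psi x : graph_set (appB phi psi) x ->
  exists u, (forall y, D u y -> graph_set psi y) /\ graph_set (appB phi (tokens u)) x.
Proof.
rewrite appB_run graph_set_derivable => /derivable_compact[s [sF Hs]].
pose query z := pr1 (pr2 z).
(* Of the finitely many facts used, only the oracle values at odd positions come from [psi]; their
   tokens form the finite set. *)
exists (iset [seq token (query z)./2 (pr2 (pr2 z)) | z <- s & (pr1 z == 1) && odd (query z)]); split.
  move=> y; rewrite -[D _ _]/(is_true (bit _ _)) bit_iset => /mapP[z].
  rewrite mem_filter => /andP[/andP[/eqP z1 od] /sF]; rewrite /run_facts z1 /pjoin -/(query z) od.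
  by move=> Hz ->; apply: graph_token.
rewrite appB_run graph_set_derivable; apply: derivable_mono Hs => z sz.
have := sF z sz; rewrite /run_facts; case E: (pr1 z) => [|[|k]] //.
rewrite /pjoin -/(query z); case od: odd => // _.
rewrite /tokens -[D _ _]/(is_true (bit _ _)) bit_iset; apply/mapP; exists z => //.
by rewrite mem_filter E od.
Qed.

Lemma graph_set_appB phi psi : graph_set (appB phi psi) = appG (graph_set phi) (graph_set psi).
Proof.
apply: functional_extensionality => x; apply: propositional_extensionality.
split=> [Hx|[u [Hu uB]]].
  case: (posnP x) => [->|x0].
    (* The witness works because [cpair 0 0] is 0 and [D_0] is empty. *)
    by exists 0; split=> [|y]; [apply: graph_zero | rewrite -[D _ _]/(is_true (bit _ _)) bit0].
  by have [u [uB Hu]] := graph_set_app_compact Hx; exists u; split=> //; apply: graph_app.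
(* Tokens of [phi], used as operator elements, can contribute only the point 0, which every
   [graph_set] contains. *)
case: (posnP x) => [->|x0]; first exact: graph_zero.
by apply: graph_set_app_mono (graph_set_cpair Hu x0) => n v /uB /graph_set_token.
Qed.

Section OracleFacts.
Variables (X : nat -> Prop) (e0 : nat).

Definition code_fact_clause := Clause xpredT [::] (fun _ => mem_atom 0 (cpair 0 e0)).
Definition chi_true_clause := Clause xpredT [:: (fun e => cpair 0 (var 0 e).*2)]
  (fun e => mem_atom 0 (cpair 1 (cpair (var 0 e) 1))).
Definition chi_false_clause := Clause xpredT [:: (fun e => cpair 0 (var 0 e).*2.+1)]
  (fun e => mem_atom 0 (cpair 1 (cpair (var 0 e) 0))).
Definition chi_program := [:: code_fact_clause; chi_true_clause; chi_false_clause].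

(** The value 1 at [n] is derived from the element [2n] of [join_compl X] and the value 0 from
    [2n+1]: both positive and negative information on [X] is consumed. *)
Lemma run_facts_chi_le_e : le_e (run_facts (eq e0) (chi X)) (join_compl X).
Proof.
have ch : recursive1 (mem_atom 0) by computability.
suff cH c : List.In c chi_program -> computable_clause c.
  have [R [cR HR]] := derivable_le_e (join_compl X) cH ch; exists R; split=> // x.
  rewrite -HR; split=> [|Hd].
    rewrite -{2}(cpair_pr x) /run_facts; case: (pr1 x) => [<-|[|k]] //.
      by apply: (@derivable_intro _ _ code_fact_clause [::]) => //; left.
    rewrite -{3}(cpair_pr (pr2 x)); move: (pr1 (pr2 x)) => m [[Xm ->]|[Xm ->]].
      apply: (@derivable_intro _ _ chi_true_clause [:: m]) => //; first by right; left.
      by split=> //; apply: derivable_fact; rewrite /join_compl odd_double doubleK.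
    apply: (@derivable_intro _ _ chi_false_clause [:: m]) => //; first by right; right; left.
    by split=> //; apply: derivable_fact; rewrite /join_compl oddS odd_double -[_./2]/(uphalf _) uphalf_double.
  rewrite -[run_facts _ _ _](holds_mem (join_compl X) (fun _ => chi X) (fun _ => run_facts (eq e0) (chi X)) 0).
  apply: derivable_holds Hd; sound_clauses.
  - by rewrite run_facts_code.
  - by rewrite run_facts_oracle /join_compl odd_double doubleK => _ [H _]; left.
  - rewrite run_facts_oracle /join_compl oddS odd_double -[_./2]/(uphalf _) uphalf_double.
    by move=> _ [H _]; right.
by move: c; computable_clauses.
Qed.

End OracleFacts.

Theorem theorem7p6 (X Y : nat -> Prop) :
  (exists f : pfun -> (nat -> Prop), embedding_BG X Y f) <-> le_e (join_compl X) Y.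
Proof.
split=> [[f embf]|XY]; first exact: join_compl_le_e embf.
exists graph_set; split.
- move=> phi [e He]; have -> : phi = run_fun (eq e) (chi X).
    apply: pfun_ext => n v; rewrite He; split=> [Hv|[_ [<- //]]].
    by exists e.
  exact: le_e_trans (graph_set_le_e _ _) (le_e_trans (run_facts_chi_le_e X e) XY).
(* Injectivity: the tokens in the image recover the graph of the function. *)
- move=> phi psi _ _ E; apply: pfun_ext => n v.
  by split=> /graph_token; [rewrite E | rewrite -E]; apply: graph_set_token.
- by move=> phi psi _ _; apply: graph_set_appB.
Qed.
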